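(* Let $n$ be a positive integer, let $0 \le k \le n$, let $m$ be a positive integer and let $a$ be a nonnegative integer. Then: (1) $\displaystyle\sum_{\lambda \in \mathrm{Par}((m^n))} \mathrm{sp}^{(k,n-k)}_{\lambda+(a^n)}(x_1, \dots, x_k \mid x_{k+1}, \dots, x_n) = o^B_{((m/2)^n)}(x_1, \dots, x_n)\cdot \mathrm{sp}_{((m/2+a)^k)}(x_1, \dots, x_k)\cdot (x_{k+1} \cdots x_n)^{m/2+a}.$ (2) If $m$ is even, then $\displaystyle\sum_{\lambda \in \mathrm{Even}((m^n))} \mathrm{sp}^{(k,n-k)}_{\lambda+(a^n)}(x_1, \dots, x_k \mid x_{k+1}, \dots, x_n) = \mathrm{sp}_{((m/2)^n)}(x_1, \dots, x_n)\cdot \mathrm{sp}_{((m/2+a)^k)}(x_1, \dots, x_k)\cdot (x_{k+1} \cdots x_n)^{m/2+a}.$ (3) $\displaystyle\Big(\sum_{\lambda \in \mathrm{Even}'((m^n))} + \sum_{\lambda \in \mathrm{Odd}'((m^n))}\Big) \mathrm{sp}^{(k,n-k)}_{\lambda+(a^n)}(x_1, \dots, x_k \mid x_{k+1}, \dots, x_n) = o^D_{((m/2)^n)}(x_1, \dots, x_n)\cdot \mathrm{sp}_{((m/2+a)^k)}(x_1, \dots, x_k)\cdot (x_{k+1} \cdots x_n)^{m/2+a}.$ (4) $\displaystyle\Big(\sum_{\lambda \in \mathrm{Even}'((m^n))} - \sum_{\lambda \in \mathrm{Odd}'((m^n))}\Big) \mathrm{sp}^{(k,n-k)}_{\lambda+(a^n)}(x_1,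 \dots, x_k \mid x_{k+1}, \dots, x_n) = (-1)^n\cdot \mathrm{sp}_{((m/2-1)^n)}(x_1, \dots, x_n)\cdot o^D_{((m/2+a+1)^k)}(x_1, \dots, x_k)\cdot \prod_{i=k+1}^n x_i^{m/2+a}(x_i - x_i^{-1}).$
   Context: Variables $x_1,\dots,x_n$ are indeterminates; half-integer powers mean powers of formal square roots $x_i^{1/2}$. For $c \in \mathbb{Z}\cup(\mathbb{Z}+1/2)$, $(c^n)=(c,\dots,c)$ ($n$ entries), and for a sequence $\lambda=(\lambda_1,\dots,\lambda_n)$, $\lambda+(c^n)=(\lambda_1+c,\dots,\lambda_n+c)$. A partition of length $\le n$ is written $\lambda=(\lambda_1\ge\dots\ge\lambda_n\ge 0)$; $\lambda'$ denotes the conjugate partition. $\mathrm{Par}((m^n))$ is the set of partitions with at most $n$ parts and $\lambda_1\le m$; $\mathrm{Even}((m^n))$ is the subset where every $\lambda_i$ ($1\le i\le n$) is even; $\mathrm{Even}'((m^n))$ (resp. $\mathrm{Odd}'((m^n))$) is the subset where every $\lambda'_i$ ($1\le i\le m$) is even (resp. odd). A half-partition of length $n$ is a weakly decreasing sequence of positive elements of $\mathbb{Z}_{\ge0}+1/2$. Symplectic character: for a weakly decreasing sequence $\lambda=(\lambda_1,\dots,\lambda_n)$ whose entries are all integers or all in $\mathbb{Z}+1/2$, with $\lambda_n\ge -1/2$, $\mathrm{sp}_\lambda(x_1,\dots,x_n)=\det\big(x_j^{\lambda_i+n-i+1}-x_j^{-(\lambda_i+n-i+1)}\big)_{1\le i,j\le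 n}\big/\det\big(x_j^{n-i+1}-x_j^{-(n-i+1)}\big)_{1\le i,j\le n}$ (for $n=0$ it is $1$). Orthogonal characters: for a partition or half-partition $\lambda$ of length $n$, $o^B_\lambda(x_1,\dots,x_n)=\det\big(x_j^{\lambda_i+n-i+1/2}-x_j^{-(\lambda_i+n-i+1/2)}\big)_{i,j}\big/\det\big(x_j^{n-i+1/2}-x_j^{-(n-i+1/2)}\big)_{i,j}$, $o^D_\lambda(x_1,\dots,x_n)=\epsilon_\lambda\cdot\det\big(x_j^{\lambda_i+n-i}+x_j^{-(\lambda_i+n-i)}\big)_{i,j}\big/\det\big(x_j^{n-i}+x_j^{-(n-i)}\big)_{i,j}$, where $\epsilon_\lambda=2$ if $\lambda_n>0$ and $\epsilon_\lambda=1$ if $\lambda_n=0$. Intermediate symplectic character (Proctor's character, the generating function of $(k,n-k)$-symplectic tableaux): for $0\le k\le n$ and a partition $\lambda$ with at most $n$ parts, let $M_\lambda$ be the $n\times n$ matrix with $(i,j)$ entry $\dfrac{x_j^{\lambda_i+k-i+1}}{\prod_{l=k+1}^n(1-x_j^{-1}x_l)}-\dfrac{x_j^{-(\lambda_i+k-i+1)}}{\prod_{l=k+1}^n(1-x_jx_l)}$ for $1\le j\le k$, and $x_j^{\lambda_i+n-i}$ for $k<j\le n$. Then $\mathrm{sp}^{(k,n-k)}_\lambda(x_1,\dots,x_k\mid x_{k+1},\dots,x_n)=\det M_\lambda/\det M_{\emptyset}$ (a Laurent polynomial). In particular $\mathrm{sp}^{(n,0)}_\lambda=\mathrm{sp}_\lambda$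 and $\mathrm{sp}^{(0,n)}_\lambda$ is the Schur function $s_\lambda(x_1,\dots,x_n)$. *)

(* Defs.v *)
From mathcomp Require Import all_boot all_order all_algebra.
From mathcomp Require Export mpoly.

Set Implicit Arguments.
Unset Strict Implicit.
Unset Printing Implicit Defensive.

Import Order.TTheory GRing.Theory Num.Theory.
Local Open Scope ring_scope.

(* The indeterminates of [{mpoly rat[n]}] are the formal square roots
   x_i^(1/2); hence x_i = (xroot i) ^+ 2, and every identity below lives in the
   field of rational functions in x_1^(1/2), ..., x_n^(1/2). *)
Definition ratfun (n : nat) : fieldType := {fraction {mpoly rat[n]}}.

Definition xroot (n : nat) (i : 'I_n) : ratfun n :=
  tofrac ('X_i : {mpoly rat[n]}).

Definition xvar (n : nat) (i : 'I_n) : ratfun n := xroot i ^+ 2.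

(* If r is the chosen square root of x, then [hpow r c] is x^c for
   c \in Z \cup (Z + 1/2): then 2c is an integer and x^c = r^(2c).
   It is only meaningful for such c. *)
Definition hpow (F : fieldType) (r : F) (c : rat) : F := r ^ numq (2 * c).

(* A sequence (lambda_1, ..., lambda_n) is a function on 'I_n; the ordinal i
   stands for the 1-based index i.+1. *)
Definition cst_seq (n : nat) (c : rat) : 'I_n -> rat := fun _ => c.

Section Characters.

Variables (F : fieldType) (n : nat).

(* For the three classical characters, r lists the square roots
   x_1^(1/2), ..., x_n^(1/2) of the variables.  For n = 0 all determinants are
   empty, hence equal to 1, and so are the characters. *)
Variables (r : 'I_n -> F) (lam : 'I_n -> rat).

Definition sp_num (mu : 'I_n -> rat) : 'M[F]_n :=
  \matrix_(i < n, j < n)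
    (hpow (r j) (mu i + n%:R - i.+1%:R + 1)
     - hpow (r j) (- (mu i + n%:R - i.+1%:R + 1))).

Definition sp : F := \det (sp_num lam) / \det (sp_num (cst_seq 0)).

Definition oB_num (mu : 'I_n -> rat) : 'M[F]_n :=
  \matrix_(i < n, j < n)
    (hpow (r j) (mu i + n%:R - i.+1%:R + 1 / 2)
     - hpow (r j) (- (mu i + n%:R - i.+1%:R + 1 / 2))).

Definition oB : F := \det (oB_num lam) / \det (oB_num (cst_seq 0)).

Definition oD_num (mu : 'I_n -> rat) : 'M[F]_n :=
  \matrix_(i < n, j < n)
    (hpow (r j) (mu i + n%:R - i.+1%:R)
     + hpow (r j) (- (mu i + n%:R - i.+1%:R))).

(* 2 if the last entry lambda_n exists and is positive, 1 otherwise. *)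
Definition oD_eps : F :=
  if [exists i : 'I_n, (i.+1 == n) && (0 < lam i)] then 2 else 1.

Definition oD : F := oD_eps * (\det (oD_num lam) / \det (oD_num (cst_seq 0))).

End Characters.

(* Proctor's intermediate symplectic character, through its bialternant
   formula; here x lists the variables themselves, the first k of which are the
   symplectic ones. *)
Definition spI_num (F : fieldType) (n k : nat) (x : 'I_n -> F)
    (mu : 'I_n -> nat) : 'M[F]_n :=
  \matrix_(i < n, j < n)
    if (j < k)%N then
      x j ^ ((mu i)%:Z + k%:Z - i.+1%:Z + 1)
        / \prod_(l < n | (k <= l)%N) (1 - (x j)^-1 * x l)
      - x j ^ (- ((mu i)%:Z + k%:Z - i.+1%:Z + 1))
        / \prod_(l < n | (k <= l)%N) (1 - x j * x l)
    else x j ^ ((mu i)%:Z + n%:Z - i.+1%:Z).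

Definition spI (F : fieldType) (n k : nat) (x : 'I_n -> F)
    (lam : 'I_n -> nat) : F :=
  \det (spI_num k x lam) / \det (spI_num k x (fun _ => 0%N)).

Section Partitions.

Variables n m : nat.

Definition Par : {set {ffun 'I_n -> 'I_m.+1}} :=
  [set lam : {ffun 'I_n -> 'I_m.+1} |
    [forall i : 'I_n, forall j : 'I_n, (i <= j)%N ==> (lam j <= lam i)%N]].

(* lambda'_(j+1) = #{i | lambda_i >= j+1}. *)
Definition conj_part (lam : {ffun 'I_n -> 'I_m.+1}) (j : 'I_m) : nat :=
  #|[set i : 'I_n | (j.+1 <= lam i)%N]|.

Definition Even : {set {ffun 'I_n -> 'I_m.+1}} :=
  [set lam in Par | [forall i : 'I_n, ~~ odd (lam i)]].

Definition Even' : {set {ffun 'I_n -> 'I_m.+1}} :=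
  [set lam in Par | [forall j : 'I_m, ~~ odd (conj_part lam j)]].

Definition Odd' : {set {ffun 'I_n -> 'I_m.+1}} :=
  [set lam in Par | [forall j : 'I_m, odd (conj_part lam j)]].

End Partitions.

Definition shift_part (n m a : nat) (lam : {ffun 'I_n -> 'I_m.+1}) :
  'I_n -> nat := fun i => (lam i + a)%N.

Definition first_vars (T : Type) (n k : nat) (hk : (k <= n)%N) (r : 'I_n -> T) :
  'I_k -> T := fun j => r (widen_ord hk j).

(* Main.v *)
Require Import Defs.
From mathcomp Require Import all_boot all_order all_algebra.
From mathcomp Require Import perm ring zify.

Set Implicit Arguments.
Unset Strict Implicit.
Unset Printing Implicit Defensive.

Import Order.TTheory GRing.Theory Num.Theory.
Local Open Scope ring_scope.

(* Expanding each of the first k columns of M_lambda into its two terms writes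
   det M_lambda as a sum, over the choices y_j = x_j^{+-1}, of a weight times the
   alternant det(y_j^{lambda_i+n-i}).  The sum over lambda is thereby reduced to
   bounded Schur sums (the case k = 0), which are invariant, up to an explicit
   sign, under inversion of a variable; they factor out, and the remaining
   weighted sum of Vandermonde determinants is the case of a constant sequence,
   where the products over l > k cancel against Vandermonde factors.

   For the bounded Schur sums (Macdonald's identities), expanding along the first
   row the alternants with lambda_1 = m gives a recursion on n and m.  The claimed
   values, expanded over sign choices, satisfy it term by term: the required
   identities are Lagrange interpolation formulas.  Taking m = 0 then yields the
   Weyl denominator formulas. *)

(** * Partitions in a box, encoded as lists *)

Section BoxedPartitions.

Local Open Scope nat_scope.

(** Zero parts are kept, so every list has length exactly [n]. Enumerating by the first part matches
    the expansion of a determinant along its first row. *)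
Fixpoint box_parts (n m : nat) : seq (seq nat) :=
  if n is n'.+1 then
    flatten [seq [seq p :: l | l <- box_parts n' p] | p <- iota 0 m.+1]
  else [:: [::]].

Lemma box_partsE n m :
  box_parts n.+1 m
  = flatten [seq [seq p :: l | l <- box_parts n p] | p <- iota 0 m.+1].
Proof. by []. Qed.

Lemma box_parts0 n : box_parts n.+1 0 = [seq 0 :: l | l <- box_parts n 0].
Proof. by rewrite /= cats0. Qed.

Lemma box_partsS n m :
  box_parts n.+1 m.+1
  = box_parts n.+1 m ++ [seq m.+1 :: l | l <- box_parts n m.+1].
Proof.
by rewrite !box_partsE -[in LHS](addn1 m.+1) iotaD map_cat flatten_cat /= cats0.
Qed.

Lemma mem_box_parts n m l :
  (l \in box_parts n m) = (size l == n) && path geq m l.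
Proof.
elim: n m l => [|n IHn] m l; first by case: l.
rewrite box_partsE; apply/flatten_mapP/idP => [[p]|].
  rewrite mem_iota add0n ltnS => /andP[_ lepm] /mapP[l']; rewrite IHn.
  by case/andP=> /eqP <- pl' -> /=; rewrite eqxx lepm.
case: l => // p l /andP[/=]; rewrite eqSS => szl /andP[lepm pl].
exists p; first by rewrite (mem_iota 0 m.+1).
by apply/mapP; exists l => //; rewrite IHn szl.
Qed.

Lemma uniq_box_parts n m : uniq (box_parts n m).
Proof.
elim: n m => // n IHn; elim=> [|m IHm].
  by rewrite box_parts0 map_inj_uniq // => x y [].
rewrite box_partsS cat_uniq IHm map_inj_uniq ?IHn ?andbT => [|x y [] //].
apply/hasPn => _ /mapP[l _ ->]; rewrite mem_box_parts /=.
by rewrite ltnn /= andbF.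
Qed.

Definition part_seq (n m : nat) (lam : {ffun 'I_n -> 'I_m.+1}) : seq nat :=
  [seq (lam i : nat) | i <- enum 'I_n].

Lemma size_part_seq n m (lam : {ffun 'I_n -> 'I_m.+1}) : size (part_seq lam) = n.
Proof. by rewrite size_map size_enum_ord. Qed.

Lemma nth_part_seq n m (lam : {ffun 'I_n -> 'I_m.+1}) (i : 'I_n) :
  nth 0 (part_seq lam) i = lam i.
Proof. by rewrite (nth_map i) ?size_enum_ord // nth_ord_enum. Qed.

Lemma part_seq_inj n m : injective (@part_seq n m).
Proof.
move=> u v uv; apply/ffunP => i; apply/val_inj => /=.
by rewrite -!nth_part_seq uv.
Qed.

Lemma perm_part_seq n m :
  perm_eq [seq part_seq lam | lam <- enum (Par n m)] (box_parts n m).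
Proof.
apply: uniq_perm.
- by rewrite (map_inj_uniq (@part_seq_inj n m)) enum_uniq.
- exact: uniq_box_parts.
move=> l; rewrite mem_box_parts; apply/mapP/andP.
  case=> lam; rewrite mem_enum inE => /forallP lamP ->.
  rewrite size_part_seq; split=> //; apply/(pathP 0) => i.
  rewrite size_part_seq => lt_in; case: i lt_in => [|i] lt_in /=.
    by rewrite (nth_part_seq lam (Ordinal lt_in)) -ltnS.
  rewrite (nth_part_seq lam (Ordinal lt_in)).
  rewrite (nth_part_seq lam (Ordinal (ltnW lt_in))).
  have /forallP/(_ (Ordinal lt_in))/implyP := lamP (Ordinal (ltnW lt_in)).
  by apply; exact: leqnSn.
case=> /eqP szl pl.
have geqT : transitive geq by move=> a b c ab bc; apply: leq_trans bc ab.
have le_m i : nth 0 l i < m.+1.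
  have [lt_i|le_i] := ltnP i (size l); last by rewrite nth_default.
  by have /allP/(_ _ (mem_nth 0 lt_i)) := order_path_min geqT pl; rewrite ltnS.
exists [ffun i : 'I_n => inord (nth 0 l i)].
  rewrite mem_enum inE; apply/forallP => i; apply/forallP => j.
  apply/implyP => le_ij; rewrite !ffunE !inordK //.
  apply: (sorted_leq_nth geqT _ 0 (path_sorted pl)) => //.
  - exact: leqnn.
  - by rewrite inE szl.
  - by rewrite inE szl.
apply: (@eq_from_nth _ 0); first by rewrite size_part_seq.
move=> i; rewrite szl => lt_in.
by rewrite (nth_part_seq _ (Ordinal lt_in)) ffunE inordK.
Qed.

Lemma big_Par (V : nmodType) n m (P : pred (seq nat)) (f : seq nat -> V) :
  (\sum_(lam in Par n m | P (part_seq lam)) f (part_seq lam)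
   = \sum_(l <- box_parts n m | P l) f l)%R.
Proof.
rewrite -(perm_big _ (perm_part_seq n m)) /= big_map.
by rewrite -big_enum_cond /=.
Qed.

Definition conj_seq (l : seq nat) (j : nat) : nat := count (fun x => j < x) l.
Definition conj_even m l := all (fun j => ~~ odd (conj_seq l j)) (iota 0 m).
Definition conj_odd m l := all (fun j => odd (conj_seq l j)) (iota 0 m).

Lemma conj_part_seq n m (lam : {ffun 'I_n -> 'I_m.+1}) (j : 'I_m) :
  conj_part lam j = conj_seq (part_seq lam) j.
Proof.
rewrite /conj_part /conj_seq /part_seq count_map -size_filter enumT.
rewrite cardsE cardE /enum_mem; congr size.
Qed.

Lemma conj_seqE n m l : l \in box_parts n m -> conj_seq l m = 0.
Proof.
rewrite mem_box_parts => /andP[_ pl]; apply/eqP; rewrite -leqn0 leqNgt -has_count.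
apply/hasPn => x /(allP (order_path_min _ pl)) /=; rewrite -leqNgt; apply.
by move=> a b c ab bc; apply: leq_trans bc ab.
Qed.

(** A new first row of length [m] adds one cell to each of the [m] columns and so reverses all their
    parities. *)
Lemma conj_even_cons m l : conj_even m (m :: l) = conj_odd m l.
Proof.
by apply: eq_in_all => j; rewrite mem_iota /= => ->; rewrite /= negbK.
Qed.

Lemma conj_odd_cons m l : conj_odd m (m :: l) = conj_even m l.
Proof. by apply: eq_in_all => j; rewrite mem_iota /= => ->. Qed.

(** When all parts are at most [m], column [m.+1] is empty and has even length 0: this leaves the
    even condition unchanged and makes the odd one fail. *)
Lemma conj_evenS n m l :
  l \in box_parts n m -> conj_even m.+1 l = conj_even m l.
Proof.
move=> lP; rewrite /conj_even -addn1 iotaD all_cat /= add0n.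
by rewrite (conj_seqE lP) !andbT.
Qed.

Lemma conj_oddS n m l : l \in box_parts n m -> conj_odd m.+1 l = false.
Proof.
move=> lP; rewrite /conj_odd -addn1 iotaD all_cat /= add0n.
by rewrite (conj_seqE lP) !andbF.
Qed.

End BoxedPartitions.

(** * Multilinearity of the determinant in its columns *)

Section Determinants.

Variable F : comNzRingType.

Lemma det_sum_col (I : finType) n (f : I -> 'I_n -> 'I_n -> F) :
  \det (\matrix_(i, j) \sum_b f b i j)
  = \sum_(e : {ffun 'I_n -> I}) \det (\matrix_(i, j) f (e j) i j).
Proof.
under [RHS]eq_bigr do rewrite -det_tr.
rewrite -det_tr /determinant exchange_big /=; apply: eq_bigr => s _.
rewrite -mulr_sumr; congr (_ * _).
under eq_bigr do rewrite !mxE.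
rewrite bigA_distr_bigA /=; apply: eq_bigr => e _.
by apply: eq_bigr => i _; rewrite !mxE.
Qed.

Lemma det_scale_col n (w : 'I_n -> F) (A : 'I_n -> 'I_n -> F) :
  \det (\matrix_(i, j) (w j * A i j)) = \prod_j w j * \det (\matrix_(i, j) A i j).
Proof.
rewrite -det_tr -[in RHS]det_tr /determinant mulr_sumr.
apply: eq_bigr => s _; rewrite mulrCA -big_split; congr (_ * _).
by apply: eq_bigr => i _; rewrite !mxE.
Qed.

End Determinants.

(** * Products over pairs of indices *)

Section PairProducts.

Variable F : comNzRingType.

Definition pair_prod n (P : 'I_n -> 'I_n -> F) : F :=
  \prod_(i < n) \prod_(j < n | (i < j)%N) P i j.

Lemma eq_pair_prod n (P Q : 'I_n -> 'I_n -> F) :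
  (forall i j : 'I_n, (i < j)%N -> P i j = Q i j) -> pair_prod P = pair_prod Q.
Proof. by move=> eqPQ; apply: eq_bigr => i _; apply: eq_bigr => j /eqPQ. Qed.

Lemma ltn_lift n (j : 'I_n.+1) (i i' : 'I_n) :
  (lift j i < lift j i')%N = (i < i')%N.
Proof. by rewrite !ltnNge leq_bump2. Qed.

Lemma lift_lt n (j : 'I_n.+1) (i : 'I_n) : (lift j i < j)%N = (i < j)%N.
Proof.
rewrite /= /bump; case: (leqP j i) => /= [le_ji|//].
by apply/negbTE; rewrite -leqNgt (leq_trans le_ji) // leqnSn.
Qed.

Lemma lt_lift n (j : 'I_n.+1) (i : 'I_n) : (j < lift j i)%N = ~~ (i < j)%N.
Proof.
by rewrite -lift_lt ltn_neqAle -leqNgt neq_lift.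
Qed.

Lemma prod_sign_lift n (j : 'I_n.+1) :
  \prod_(i < n) (if (i < j)%N then -1 else 1) = (-1) ^+ j :> F.
Proof.
have le_jn : (j <= n)%N by rewrite -ltnS.
suff -> : \prod_(i < n) (if (i < j)%N then -1 else 1) = \prod_(i < j) (-1) :> F.
  by rewrite prodr_const card_ord.
by rewrite (big_ord_widen n (fun=> -1) le_jn) [RHS]big_mkcond.
Qed.

(** The pairs containing [j] are pulled out; the [j] of them in which it comes second are reversed,
    each at the cost of a sign. *)
Lemma pair_prod_lift n (P : 'I_n.+1 -> 'I_n.+1 -> F) (j : 'I_n.+1) :
  (forall i : 'I_n.+1, (i < j)%N -> P i j = - P j i) ->
  pair_prod P = (-1) ^+ j * \prod_(i < n) P j (lift j i)
                * pair_prod (fun i i' => P (lift j i) (lift j i')).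
Proof.
move=> antiP; rewrite /pair_prod (bigD1_ord j) //= big_mkcond (bigD1_ord j) //=.
rewrite ltnn mul1r.
under [X in _ * X]eq_bigr => i _ do
  rewrite big_mkcond (bigD1_ord j) //= lift_lt.
rewrite big_split mulrA /=; congr (_ * _).
  rewrite -prod_sign_lift -!big_split; apply: eq_bigr => i _ /=.
  rewrite -/(lift j i) lt_lift; case: ltnP => [lt_ij|_] /=; last by rewrite mulr1 mul1r.
  by rewrite mul1r mulN1r antiP // lift_lt.
apply: eq_bigr => i _; rewrite [RHS]big_mkcond; apply: eq_bigr => i' _.
by rewrite ltn_lift.
Qed.

End PairProducts.

(** * Lagrange interpolation *)

Section Lagrange.

Variable F : fieldType.

(** [q] equals its interpolant at the nodes [s], because their difference has size at most [size s]
    and vanishes on [s]. The basis polynomials [b x] are monic of size [size s], so the sum is read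
    off from the top coefficients. *)
Lemma lagrange_lead (s : seq F) (q : {poly F}) :
  uniq s -> (size q <= size s)%N ->
  \sum_(x <- s) q.[x] / \prod_(y <- s | y != x) (x - y) = q`_(size s).-1.
Proof.
move=> us szq.
pose b x : {poly F} := \prod_(y <- s | y != x) ('X - y%:P).
have szb x : x \in s -> size (b x) = size s.
  move=> xs; rewrite /b -big_filter size_prod_XsubC -rem_filter // size_rem //.
  by rewrite prednK //; case: (s) xs.
have bE x : (b x).[x] = \prod_(y <- s | y != x) (x - y).
  by rewrite horner_prod; apply: eq_bigr => y _; rewrite hornerXsubC.
have b0 x y : y \in s -> y != x -> (b x).[y] = 0.
  move=> ys yx; apply/rootP; rewrite /b -big_filter root_prod_XsubC.
  by rewrite mem_filter yx.
pose d x := \prod_(y <- s | y != x) (x - y).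
have d0 x : d x != 0.
  rewrite prodf_seq_neq0; apply/allP => y _; apply/implyP.
  by rewrite subr_eq0 eq_sym.
suff qE : q = \sum_(x <- s) (q.[x] / d x) *: b x.
  rewrite [in RHS]qE coef_sum !big_seq; apply: eq_bigr => x xs.
  rewrite -/(d x) coefZ.
  suff -> : (b x)`_(size s).-1 = 1 by rewrite mulr1.
  have : b x \is monic by apply: monic_prod => y _; exact: monicXsubC.
  by move/monicP; rewrite lead_coefE szb.
apply/eqP; rewrite -subr_eq0; apply/eqP.
apply: (@roots_geq_poly_eq0 _ _ s) => //.
  apply/allP => x xs; apply/rootP; rewrite hornerD hornerN horner_sum.
  rewrite (bigD1_seq x) //= hornerZ bE -/(d x) divfK ?d0 // big_seq_cond.
  rewrite big1 ?addr0 ?subrr // => y /andP[ys yx].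
  by rewrite hornerZ b0 ?mulr0 // eq_sym.
apply: leq_trans (size_polyD _ _) _; rewrite geq_max szq size_polyN /=.
rewrite big_seq; apply: leq_trans (size_sum _ _ _) _.
apply/bigmax_leqP_seq => x _ xs.
by apply: leq_trans (size_scale_leq _ _) _; rewrite szb.
Qed.

End Lagrange.

(** * Alternants, and sums over choices of inverted variables *)

Section Alternants.

Variable F : fieldType.

(** The default 0 of [nth] makes [[::]] stand for the empty partition, whatever [n] is. *)
Definition alt n (y : 'I_n -> F) (l : seq nat) : F :=
  \det (\matrix_(i < n, j < n) y j ^+ (nth 0%N l i + (n - i.+1))).

Definition vdm n (y : 'I_n -> F) : F := pair_prod (fun i j => y i - y j).

Lemma eq_alt n (y z : 'I_n -> F) l : y =1 z -> alt y l = alt z l.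
Proof.
by move=> yz; congr (\det _); apply/matrixP => i j; rewrite !mxE yz.
Qed.

Lemma alt_cons n (y : 'I_n.+1 -> F) p l :
  alt y (p :: l)
  = \sum_(j < n.+1) (-1) ^+ j * y j ^+ (p + n) * alt (fun i => y (lift j i)) l.
Proof.
rewrite /alt (expand_det_row _ ord0); apply: eq_bigr => j _.
rewrite !mxE /= /cofactor add0n subn1 /= mulrA [_ * (-1) ^+ _]mulrC.
congr (_ * _); congr (\det _); apply/matrixP => i i'.
by rewrite !mxE.
Qed.

(** Reversing the order of both rows and columns gives the matrix [Vandermonde]; the two signs
    cancel. *)
Lemma alt_nil n (y : 'I_n -> F) : alt y [::] = vdm y.
Proof.
pose s : {perm 'I_n} := perm (@rev_ord_inj n).
transitivity (\det (Vandermonde n (\row_j y (s j)))).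
  have -> : Vandermonde n (\row_j y (s j)) = row_perm s (col_perm s
              (\matrix_(i < n, j < n) y j ^+ (nth 0%N [::] i + (n - i.+1)))).
    apply/matrixP => i j; rewrite !mxE nth_nil add0n; congr (_ ^+ _).
    by rewrite permE /= subnSK // subKn // ltnW.
  rewrite row_permE col_permE !det_mulmx !det_perm odd_permV.
  by rewrite mulrCA -signr_addb addbb expr0 mulr1.
rewrite det_Vandermonde /vdm /pair_prod (exchange_big_dep predT) //=.
rewrite (reindex_inj (perm_inj (s := s))) /=; apply: eq_bigr => i _.
rewrite (reindex_inj (perm_inj (s := s))) /=.
apply: eq_big => [j|j _]; last by rewrite !mxE !permE !rev_ordK.
by rewrite !permE /= ltn_sub2lE.
Qed.

Definition flip n (e : {ffun 'I_n -> bool}) (y : 'I_n -> F) : 'I_n -> F :=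
  fun j => if e j then y j else (y j)^-1.

(** The contribution of the roots e_i + e_j: [vdm y * den y] is the Weyl denominator of type D, up
    to the factor 2 of its last row. *)
Definition den n (y : 'I_n -> F) : F := pair_prod (fun i j => 1 - (y i * y j)^-1).

(** The nonvanishing conditions on the variables behind the divisions below. They survive both the
    removal and the inversion of variables. *)
Definition generic n (y : 'I_n -> F) : Prop :=
  [/\ forall i, y i != 0, forall i, y i ^+ 2 != 1,
      forall i j, i != j -> y i != y j & forall i j, i != j -> y i * y j != 1].

Lemma generic_lift n (y : 'I_n.+1 -> F) j :
  generic y -> generic (fun i => y (lift j i)).
Proof.
by case=> y0 y1 yi yn; split=> [i|i|i i' ii'|i i' ii'] //; [apply: yi|apply: yn];
   rewrite (inj_eq lift_inj).
Qed.

Lemma generic_den n (y : 'I_n -> F) : generic y -> den y != 0.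
Proof.
case=> _ _ _ yn; apply/prodf_neq0 => i _; apply/prodf_neq0 => j ij.
by rewrite subr_eq0 eq_sym invr_eq1 yn // neq_ltn ij.
Qed.

Lemma generic_vdm n (y : 'I_n -> F) : generic y -> vdm y != 0.
Proof.
case=> _ _ yi _; apply/prodf_neq0 => i _; apply/prodf_neq0 => j ij.
by rewrite subr_eq0 yi // neq_ltn ij.
Qed.

(* The e-term of a Weyl numerator times the Vandermonde determinant, divided by
   the part of the Weyl denominator attached to the roots e_i +- e_j. *)
Definition sign_term n (e : {ffun 'I_n -> bool}) (y : 'I_n -> F) : F :=
  vdm (flip e y) / den y.

(** The common shape of the closed forms: [w true z] and [w false z] are the weights of keeping and
    of inverting the variable [z]. *)
Definition sign_sum n (w : bool -> F -> F) (y : 'I_n -> F) : F :=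
  \sum_(e : {ffun 'I_n -> bool})
     \prod_j w (e j) (y j) * sign_term e y.

Definition pair_fac n (e : {ffun 'I_n -> bool}) (y : 'I_n -> F) i j : F :=
  (flip e y i - flip e y j) / (1 - (y i * y j)^-1).

Lemma sign_termE n (e : {ffun 'I_n -> bool}) (y : 'I_n -> F) :
  sign_term e y = pair_prod (pair_fac e y).
Proof.
rewrite /sign_term /vdm /den /pair_prod -prodf_div; apply: eq_bigr => i _.
by rewrite -prodf_div.
Qed.

Lemma sign_term_lift n (e : {ffun 'I_n.+1 -> bool}) (y : 'I_n.+1 -> F)
    (j : 'I_n.+1) :
  sign_term e y
  = (-1) ^+ j * \prod_(i < n) pair_fac e y j (lift j i)
    * sign_term [ffun i => e (lift j i)] (fun i => y (lift j i)).
Proof.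
rewrite !sign_termE (pair_prod_lift (j := j)) => [|i _].
  congr (_ * _); apply: eq_pair_prod => i i' _.
  by rewrite /pair_fac /flip !ffunE.
by rewrite /pair_fac [y i * _]mulrC -mulNr opprB.
Qed.

(** If [e j] fails, the numerator y_i - 1/y_j is y_i times the denominator and only y_i remains; the
    fraction survives only when [e j] holds. *)
Lemma pair_facE n (e : {ffun 'I_n -> bool}) (y : 'I_n -> F) i j :
  generic y -> i != j -> e i ->
  pair_fac e y i j = y i / (if e j then (y i - (y j)^-1) / (y i - y j) else 1).
Proof.
case=> y0 y1 yi yn ij ei; rewrite /pair_fac /flip ei.
have := y0 i; have := y0 j; have := yn _ _ ij; have := yi _ _ ij.
rewrite -subr_eq0 -[y i * _ == 1]subr_eq0 => a0 b0 yj0 yi0.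
have c0 : y i * y j - 1 != 0 by [].
case: (e j); field; rewrite ?mulr1 ?yi0 ?yj0 ?a0 ?b0 ?oner_eq0 //=.
Qed.


(** What remains of a first-row expansion once the term of [e] is factored out, as [sign_sum_step]
    shows. It is a Lagrange interpolation sum whose nodes are the kept variables. *)
Definition res_sum n (e : {ffun 'I_n -> bool}) (y : 'I_n -> F) (h : F -> F) : F :=
  \sum_(j | e j) h (y j)
     * \prod_(i | e i && (i != j)) ((y j - (y i)^-1) / (y j - y i)).

(* Lagrange interpolation of r(z) \prod_i (z - 1/z_i) at the z_i and at the
   points of X, where the z_i are the y_i with e i. *)
Lemma res_sumE n (e : {ffun 'I_n -> bool}) (y : 'I_n -> F) (X : seq F)
    (r : {poly F}) : generic y -> uniq X ->
  (forall j, y j \notin X) -> r \is monic -> size r = size X ->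
  res_sum e y (fun z => (z - z^-1) * r.[z] / \prod_(x <- X) (z - x))
  = 1 - \sum_(x <- X) r.[x] / \prod_(x' <- X | x' != x) (x - x')
        * \prod_(i | e i) ((x - (y i)^-1) / (x - y i)).
Proof.
case=> y0 y1 yi yn uX yX rm szr.
pose K := [seq i <- index_enum 'I_n | e i].
pose p : {poly F} := \prod_(i | e i) ('X - (y i)^-1%:P).
have pE x : p.[x] = \prod_(i | e i) (x - (y i)^-1).
  by rewrite horner_prod; apply: eq_bigr => i _; rewrite hornerXsubC.
have pm : p \is monic by apply: monic_prod => i _; exact: monicXsubC.
have szp : size p = (size K).+1 by rewrite /p -big_filter size_prod_XsubC.
have szpr : size (p * r) = size (X ++ map y K).
  rewrite size_monicM ?monic_neq0 // szp addSn /= szr size_cat size_map.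
  by rewrite addnC.
have us : uniq (X ++ map y K).
  rewrite cat_uniq uX /=; apply/andP; split.
    by apply/hasPn => _ /mapP[i _ ->].
  rewrite map_inj_uniq ?filter_uniq ?index_enum_uniq // => i j yij.
  by apply/eqP; apply: contraTT (eqxx (y i)) => /yi; rewrite yij.
(* The polynomial [p * r] is monic and its size is the number of nodes, so the full interpolation
   sum is 1; the nodes in [X] account for the subtracted terms. *)
have := lagrange_lead us (eq_leq szpr).
have prm : p * r \is monic by rewrite monicMl.
rewrite -szpr -lead_coefE (monicP prm) big_cat /= => E.
apply: canRL (addrK _) _; rewrite -[RHS]E addrC; congr (_ + _).
  rewrite big_map big_filter; apply: eq_bigr => j ej.
  rewrite hornerM pE [\prod_(i | e i) _](bigD1 j) //=
    prodf_div big_cat big_map big_filter_cond /=.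
  have -> : \prod_(x <- X | x != y j) (y j - x) = \prod_(x <- X) (y j - x).
    rewrite big_seq_cond [RHS]big_seq; apply: eq_bigl => x.
    by case: (boolP (x \in X)) => //= xX; apply: contraNneq (yX j) => <-.
  have -> : \prod_(i | e i && (y i != y j)) (y j - y i)
            = \prod_(i | e i && (i != j)) (y j - y i).
    apply: eq_bigl => i; congr (_ && _); apply/idP/idP; last exact: yi.
    by apply: contraNneq => ->.
  by rewrite [in RHS]invfM; ring.
apply: eq_big_seq => x xX.
rewrite hornerM pE big_cat big_map big_filter_cond /= prodf_div.
have -> : \prod_(i | e i && (y i != x)) (x - y i) = \prod_(i | e i) (x - y i).
  apply: eq_bigl => i; case: eqP => [yx|_]; last by rewrite andbT.
  by have := yX i; rewrite yx xX.
by rewrite [in RHS]invfM; ring.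
Qed.

Lemma big_ffun_lift (V : nmodType) n (j : 'I_n.+1)
    (G : {ffun 'I_n -> bool} -> V) :
  \sum_e G e = \sum_(e : {ffun 'I_n.+1 -> bool} | e j) G [ffun i => e (lift j i)].
Proof.
pose h (e : {ffun 'I_n -> bool}) : {ffun 'I_n.+1 -> bool} :=
  [ffun i => if unlift j i is Some i' then e i' else true].
rewrite [RHS](reindex_onto h (fun e => [ffun i => e (lift j i)])) /=.
  have hK e : [ffun i => h e (lift j i)] = e.
    by apply/ffunP => i; rewrite !ffunE liftK.
  apply: eq_big => [e|e _]; rewrite hK //.
  by rewrite ffunE unlift_none eqxx.
move=> e ej; apply/ffunP => i; rewrite ffunE.
by case: unliftP => [i' ->|->]; rewrite ?ffunE ?ej.
Qed.

(** The removed variable [y j] is regarded as kept, so each term on the left belongs to some [e]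
    with [e j]. After the sums are exchanged, (-1)^j and y_j^n match the factors of [sign_term]
    involving [j]; what is left over is 1/s(y_j) times the fractions of [pair_facE]. *)
Lemma sign_sum_step n (u s t : F -> F) (y : 'I_n.+1 -> F) :
  generic y -> (forall j, s (y j) != 0) -> (forall j, u (y j) != 0) ->
  \sum_(j < n.+1) (-1) ^+ j * (y j) ^+ n * u (y j) *
     sign_sum (fun b z => if b then s z * u z else t z) (fun i => y (lift j i))
  = \sum_(e : {ffun 'I_n.+1 -> bool})
      \prod_j (if e j then s (y j) * u (y j) else t (y j)) * sign_term e y
      * res_sum e y (fun z => (s z)^-1).
Proof.
move=> gy s0 u0; have [y0 _ yi yn] := gy.
under eq_bigr => j _ do rewrite /sign_sum (big_ffun_lift j) mulr_sumr.
rewrite (exchange_big_dep predT) //=; apply: eq_bigr => e _.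
rewrite mulr_sumr; apply: eq_bigr => j ej.
rewrite (bigD1_ord j) //= ej (sign_term_lift e y j).
pose g i := if e (lift j i)
  then (y j - (y (lift j i))^-1) / (y j - y (lift j i)) else 1.
have g0 : \prod_i g i != 0.
  apply/prodf_neq0 => i _; rewrite /g; case: ifP => _; last exact: oner_neq0.
  have ij : j != lift j i by exact: neq_lift.
  rewrite mulf_neq0 ?invr_eq0 ?subr_eq0 ?yi //.
  by apply: contraNneq (yn _ _ ij) => ->; rewrite mulVf.
have -> : \prod_(i < n) pair_fac e y j (lift j i) = y j ^+ n / \prod_i g i.
  transitivity (\prod_(i < n) (y j / g i)).
    by apply: eq_bigr => i _; rewrite pair_facE ?neq_lift.
  by rewrite prodf_div prodr_const card_ord.
have -> : \prod_(i | e i && (i != j)) ((y j - (y i)^-1) / (y j - y i))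
          = \prod_i g i.
  rewrite big_mkcond (bigD1_ord j) //= eqxx andbF mul1r.
  by apply: eq_bigr => i _; rewrite eq_sym neq_lift andbT.
have -> : \prod_(i < n) (if e (lift j i) then s (y (lift j i)) * u (y (lift j i))
                         else t (y (lift j i)))
  = \prod_(i < n) (if [ffun i0 => e (lift j i0)] i
       then s (y (lift j i)) * u (y (lift j i)) else t (y (lift j i))).
  by apply: eq_bigr => i _; rewrite ffunE.
by have := s0 j; move: g0 => g0 sj0; field; rewrite sj0.
Qed.

End Alternants.

(** * Determinant form of the sign sums, and the interpolation formulas *)

Section BoundedSums.

Variable F : fieldType.
Implicit Types d n m p : nat.

Lemma eq_sign_sum n (w w' : bool -> F -> F) (y : 'I_n -> F) :
  (forall b j, w b (y j) = w' b (y j)) -> sign_sum w y = sign_sum w' y.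
Proof.
by move=> ww'; apply: eq_bigr => e _; congr (_ * _); apply: eq_bigr.
Qed.

Lemma sum_vdm_flip n (w : bool -> 'I_n -> F) (y : 'I_n -> F) :
  \sum_(e : {ffun 'I_n -> bool}) \prod_j w (e j) j * vdm (flip e y)
  = \det (\matrix_(i < n, j < n)
      (w true j * y j ^+ (n - i.+1) + w false j * y j ^- (n - i.+1))).
Proof.
pose f (b : bool) (i j : 'I_n) :=
  w b j * (if b then y j else (y j)^-1) ^+ (n - i.+1).
transitivity (\det (\matrix_(i < n, j < n) \sum_b f b i j)); last first.
  congr (\det _); apply/matrixP => i j; rewrite !mxE big_bool /f /=.
  by rewrite exprVn.
rewrite det_sum_col; apply: eq_bigr => e _.
rewrite det_scale_col -alt_nil; congr (_ * \det _).
by apply/matrixP => i j; rewrite !mxE nth_nil add0n.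
Qed.

Lemma sign_sumE n (w : bool -> F -> F) (y : 'I_n -> F) :
  sign_sum w y = \det (\matrix_(i < n, j < n)
      (w true (y j) * y j ^+ (n - i.+1) + w false (y j) * y j ^- (n - i.+1)))
    / den y.
Proof.
rewrite -(sum_vdm_flip (fun b j => w b (y j))) mulr_suml.
by apply: eq_bigr => e _; rewrite mulrA.
Qed.

Lemma sign_sum_ord0 (w : bool -> F -> F) (y : 'I_0 -> F) : sign_sum w y = 1.
Proof. by rewrite sign_sumE det_mx00 /den /pair_prod big_ord0 divr1. Qed.

(** The last row of the determinant form has exponent 0, so its two terms cancel in every column. *)
Lemma sign_sum_anti n (w : bool -> F -> F) (y : 'I_n.+1 -> F) :
  (forall j, w false (y j) = - w true (y j)) -> sign_sum w y = 0.
Proof.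
move=> wN; rewrite sign_sumE (expand_det_row _ ord_max) big1 ?mul0r // => j _.
by rewrite mxE subnn expr0 invr1 !mulr1 wN subrr mul0r.
Qed.

(** This is [res_sumE] with r = 1, and X = {-1} for d = 1 or X = {0} for d = 2: indeed (z - 1/z)/(z
    + 1) = 1 - 1/z and (z - 1/z)/z = 1 - 1/z^2. *)
Lemma res_sum_pow d n (e : {ffun 'I_n -> bool}) (y : 'I_n -> F) :
  d \in [:: 1; 2]%N -> generic y ->
  res_sum e y (fun z => 1 - z ^- d) = 1 - \prod_(i | e i) y i ^- d.
Proof.
move=> d12 gy; have [y0 y1 _ _] := gy.
have y1' j : y j + 1 != 0.
  apply: contraNneq (y1 j) => /eqP.
  by rewrite addr_eq0 => /eqP ->; rewrite sqrrN expr1n.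
move: d12; rewrite !inE => /orP[] /eqP ->.
  have := @res_sumE F n e y [:: -1] 1 gy isT.
  rewrite monic1 size_poly1 => /(_ _ isT erefl) E.
  transitivity (res_sum e y
    (fun z => (z - z^-1) * 1.[z] / \prod_(x <- [:: -1]) (z - x))).
    apply: eq_bigr => j _; congr (_ * _); rewrite hornerC mulr1 big_seq1 opprK.
    by field; rewrite y0 y1'.
  rewrite E => [|j]; last by rewrite inE -addr_eq0 y1'.
  rewrite !big_seq1 hornerC big_mkcond big_seq1 eqxx invr1 !mul1r.
  congr (1 - _); apply: eq_bigr => i _.
  have ? := y0 i; have ? : 1 + y i != 0 by rewrite addrC.
  by field; rewrite y0 -opprD oppr_eq0.
have := @res_sumE F n e y [:: 0] 1 gy isT.
rewrite monic1 size_poly1 => /(_ _ isT erefl) E.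
transitivity (res_sum e y
  (fun z => (z - z^-1) * 1.[z] / \prod_(x <- [:: 0]) (z - x))).
  apply: eq_bigr => j _; congr (_ * _); rewrite hornerC mulr1 big_seq1 subr0.
  by field; rewrite y0.
rewrite E => [|j]; last by rewrite inE y0.
rewrite !big_seq1 hornerC big_mkcond big_seq1 eqxx invr1 !mul1r.
congr (1 - _); apply: eq_bigr => i _.
by rewrite !sub0r; field; rewrite oppr_eq0 y0.
Qed.

(** This is [res_sumE] with r = z and X = {1, -1}, since (z - 1/z) z = (z - 1)(z + 1). The nodes 1
    and -1 yield the products of -1/y_i and of 1/y_i, each with coefficient 1/2. *)
Lemma res_sum_one n (e : {ffun 'I_n -> bool}) (y : 'I_n -> F) :
  2 != 0 :> F -> generic y ->
  res_sum e y (fun=> 1)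
  = 1 - (\prod_(i | e i) (y i)^-1 + \prod_(i | e i) - (y i)^-1) / 2.
Proof.
move=> two_neq0 gy; have [y0 y1 _ _] := gy.
have yp j : y j + 1 != 0.
  apply: contraNneq (y1 j) => /eqP.
  by rewrite addr_eq0 => /eqP ->; rewrite sqrrN expr1n.
have ym j : y j - 1 != 0.
  by apply: contraNneq (y1 j) => /eqP; rewrite subr_eq0 => /eqP ->; rewrite expr1n.
have n11 : 1 != -1 :> F by rewrite -addr_eq0.
have n11' : -1 != 1 :> F by rewrite eq_sym.
have uX : uniq [:: 1; -1 : F] by rewrite /= inE n11.
transitivity (res_sum e y
   (fun z => (z - z^-1) * 'X.[z] / \prod_(x <- [:: 1; -1]) (z - x))).
  apply: eq_bigr => j _; congr (_ * _); rewrite hornerX !big_cons big_nil mulr1.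
  by rewrite opprK; field; rewrite y0 yp ym.
rewrite res_sumE ?monicX ?size_polyX // => [|j]; last first.
  by rewrite !inE negb_or -subr_eq0 ym -addr_eq0 yp.
congr (1 - _); rewrite !big_cons !big_nil !eqxx (negPf n11).
rewrite (negPf n11') /= !hornerX opprK addr0 !mulr1 addrC mulrDl.
congr (_ + _).
  have -> : -1 / (-1 - 1) = 2^-1 :> F.
    by field; rewrite oppr_eq0 two_neq0.
  rewrite mulrC; congr (_ * _); apply: eq_bigr => i _.
  have ? : 1 + y i != 0 by rewrite addrC.
  by field; rewrite y0 -opprD oppr_eq0.
rewrite mul1r -[1 + 1]/(2 : F) mulrC; congr (_ * _); apply: eq_bigr => i _.
by field; rewrite y0 -opprB oppr_eq0 ym.
Qed.

End BoundedSums.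

(** * Recursion for bounded Schur sums; arbitrary parts and even parts *)

Section Recursions.

Variable F : fieldType.

Implicit Types d n m p : nat.

Definition alt_sum (P : pred (seq nat)) n m (y : 'I_n -> F) : F :=
  \sum_(l <- box_parts n m | P l) alt y l.

(** First-row expansion as an operator: the row consists of the powers [y j ^+ q], and [G] takes the
    place of the minors. *)
Definition laplace_sum n q (G : ('I_n -> F) -> F) (y : 'I_n.+1 -> F) : F :=
  \sum_(j < n.+1) (-1) ^+ j * y j ^+ q * G (fun i => y (lift j i)).

Lemma eq_laplace n q (G H : ('I_n -> F) -> F) (y : 'I_n.+1 -> F) :
  generic y -> (forall z, generic z -> G z = H z) ->
  laplace_sum q G y = laplace_sum q H y.
Proof.
by move=> gy GH; apply: eq_bigr => j _; rewrite GH //; exact: generic_lift.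
Qed.

Lemma laplaceD n q (G H : ('I_n -> F) -> F) (y : 'I_n.+1 -> F) :
  laplace_sum q (fun z => G z + H z) y = laplace_sum q G y + laplace_sum q H y.
Proof. by rewrite -big_split; apply: eq_bigr => j _; rewrite mulrDr. Qed.

Lemma laplaceZ n q c (G : ('I_n -> F) -> F) (y : 'I_n.+1 -> F) :
  laplace_sum q (fun z => c * G z) y = c * laplace_sum q G y.
Proof. by rewrite mulr_sumr; apply: eq_bigr => j _; rewrite mulrCA. Qed.

Lemma laplace_vdm n (y : 'I_n.+1 -> F) : vdm y = laplace_sum n (@vdm F n) y.
Proof.
transitivity (alt y [:: 0%N]).
  rewrite -alt_nil; congr (\det _); apply/matrixP => i j; rewrite !mxE.
  by case: i => [[|i]] //= _; rewrite !nth_nil.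
by rewrite alt_cons add0n; apply: eq_bigr => j _; rewrite alt_nil.
Qed.

Lemma alt_sum_cons (P : pred (seq nat)) n m p (y : 'I_n.+1 -> F) :
  \sum_(l <- [seq p :: l | l <- box_parts n m] | P l) alt y l
  = laplace_sum (p + n) (alt_sum (fun l => P (p :: l)) m) y.
Proof.
rewrite big_map /laplace_sum; under eq_bigr do rewrite alt_cons.
by rewrite exchange_big; apply: eq_bigr => j _; rewrite -mulr_sumr.
Qed.

Lemma alt_sum_ord0 (P : pred (seq nat)) m (y : 'I_0 -> F) :
  P [::] -> alt_sum P m y = 1.
Proof. by move=> P0; rewrite /alt_sum big_cons big_nil P0 addr0 /alt det_mx00. Qed.

Lemma alt_sumS0 (P : pred (seq nat)) n (y : 'I_n.+1 -> F) :
  alt_sum P 0 y = laplace_sum n (alt_sum (fun l => P (0%N :: l)) 0) y.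
Proof. by rewrite /alt_sum box_parts0 alt_sum_cons. Qed.

Lemma alt_sumSS (P : pred (seq nat)) n m (y : 'I_n.+1 -> F) :
  alt_sum P m.+1 y
  = alt_sum P m y + laplace_sum (m.+1 + n) (alt_sum (fun l => P (m.+1 :: l)) m.+1) y.
Proof. by rewrite /alt_sum box_partsS big_cat alt_sum_cons. Qed.

Lemma eq_alt_sum (P Q : pred (seq nat)) n m (y : 'I_n -> F) :
  {in box_parts n m, P =1 Q} -> alt_sum P m y = alt_sum Q m y.
Proof.
move=> PQ; rewrite /alt_sum big_seq_cond [RHS]big_seq_cond; apply: eq_bigl => l.
by case: (boolP (l \in _)) => //= /PQ.
Qed.

Lemma alt_sum_pred0 n m (y : 'I_n -> F) : alt_sum pred0 m y = 0.
Proof. by rewrite /alt_sum big_pred0. Qed.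

Lemma laplace0 n q (y : 'I_n.+1 -> F) : laplace_sum q (fun=> 0) y = 0.
Proof. by rewrite /laplace_sum big1 // => j _; rewrite mulr0. Qed.

(* The cases d = 1, 2 are the partitions with arbitrary and with even parts. *)
Definition dvd_parts d (l : seq nat) : bool := all (fun x => d %| x)%N l.

(** The bound is raised [d] times by one; first parts strictly between [d * p] and [d * p.+1] are
    not multiples of [d] and add nothing. *)
Lemma dvd_parts_sumS d n p (y : 'I_n.+1 -> F) : (0 < d)%N ->
  alt_sum (dvd_parts d) (d * p.+1) y
  = alt_sum (dvd_parts d) (d * p) y
    + laplace_sum (d * p.+1 + n) (alt_sum (dvd_parts d) (d * p.+1)) y.
Proof.
move=> d0; have skip k : (k < d)%N ->
  alt_sum (dvd_parts d) (d * p + k) y = alt_sum (dvd_parts d) (d * p) y.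
  elim: k => [|k IHk] kd; first by rewrite addn0.
  rewrite addnS alt_sumSS IHk 1?ltnW // -[RHS]addr0; congr (_ + _).
  rewrite -(laplace0 ((d * p + k).+1 + n) y); apply: eq_bigr => j _.
  congr (_ * _); rewrite -(alt_sum_pred0 (d * p + k).+1 (fun i => y (lift j i))).
  apply: eq_alt_sum => l _ /=; rewrite -addnS dvdn_addr ?dvdn_mulr //.
  by rewrite gtnNdvd.
case: d d0 skip => // d _ skip.
rewrite mulnS addnC addnS alt_sumSS skip //; congr (_ + _).
apply: eq_bigr => j _; congr (_ * _); apply: eq_alt_sum => l _ /=.
by rewrite -addnS dvdn_addr ?dvdn_mulr ?dvdnn.
Qed.

(** Up to elementary factors, a Weyl numerator of type B (d = 1) or C (d = 2) expanded over sign
    choices; [dvd_sign_weyl] makes this precise. *)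
Definition dvd_sign d p n (y : 'I_n -> F) : F :=
  sign_sum (fun b z => if b then (1 - z ^- d)^-1 * z ^+ (d * p)
                       else (1 - z ^+ d)^-1) y.

Lemma generic_pow_neq1 d n (y : 'I_n -> F) j :
  d \in [:: 1; 2]%N -> generic y -> y j ^+ d != 1.
Proof.
move=> d12 [_ y1 _ _]; apply: contraNneq (y1 j) => yd.
move: d12 yd; rewrite !inE => /orP[] /eqP -> yd; last by rewrite yd.
by rewrite -[y j]expr1 yd expr1n.
Qed.

(** By [res_sum_pow] each term is multiplied by 1 minus the product of the y_j^(-d) over the kept
    variables. That product is absorbed into the weights through z^(-d)/(1 - z^(-d)) = 1/(z^d -
    1). *)
Lemma dvd_sign_step d p n (y : 'I_n.+1 -> F) : d \in [:: 1; 2]%N -> generic y ->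
  laplace_sum (d * p + n) (dvd_sign d p (n := n)) y
  = dvd_sign d p y
    - sign_sum (fun b z => if b then (z ^+ d - 1)^-1 * z ^+ (d * p)
                           else (1 - z ^+ d)^-1) y.
Proof.
move=> d12 gy; have [y0 _ _ _] := gy.
have yd j : y j ^+ d - 1 != 0 by rewrite subr_eq0 generic_pow_neq1.
have ydN j : 1 - y j ^- d != 0.
  by rewrite subr_eq0 eq_sym invr_eq1 generic_pow_neq1.
have := @sign_sum_step F n (fun z => z ^+ (d * p)) (fun z => (1 - z ^- d)^-1)
  (fun z => (1 - z ^+ d)^-1) y gy.
move=> /(_ (fun j => _) (fun j => _)) E.
rewrite -[LHS]/(laplace_sum _ _ _) [LHS](_ : _ =
  \sum_(j < n.+1) (-1) ^+ j * y j ^+ n * y j ^+ (d * p)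
    * dvd_sign d p (fun i => y (lift j i))); last first.
  by apply: eq_bigr => j _; rewrite addnC exprD mulrA.
rewrite E => [|j|j]; rewrite ?invr_eq0 ?expf_neq0 //.
rewrite -sumrB; apply: eq_bigr => e _.
have -> : res_sum e y (fun z => ((1 - z ^- d)^-1)^-1) = 1 - \prod_(i | e i) y i ^- d.
  by rewrite -(res_sum_pow e d12 gy); apply: eq_bigr => j _; rewrite invrK.
rewrite -mulrA mulrBr mulr1 mulrBr; congr (_ - _).
rewrite [sign_term _ _ * _]mulrC mulrA [\prod_(i | e i) _]big_mkcond.
rewrite -big_split; congr (_ * _).
apply: eq_bigr => j _ /=; case: (e j); rewrite ?mulr1 //.
have := ydN j; have := yd j; have := expf_neq0 d (y0 j).
by move: (y j ^+ d) => z z0 z1 z1'; field; rewrite z0 z1.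
Qed.

(** Induction on [n], then on [p]. In [dvd_sign_step] the subtracted sum is antisymmetric, hence
    zero, at p = 0; at [p.+1] it equals [dvd_sign d p], which reproduces the recursion
    [dvd_parts_sumS]. *)
Lemma dvd_sumE d n p (y : 'I_n -> F) : d \in [:: 1; 2]%N -> generic y ->
  alt_sum (dvd_parts d) (d * p) y = dvd_sign d p y.
Proof.
move=> d12; have d0 : (0 < d)%N by move: d12; rewrite !inE => /orP[] /eqP ->.
elim: n p y => [|n IHn] p y gy; first by rewrite alt_sum_ord0 // /dvd_sign sign_sum_ord0.
have [y0 _ _ _] := gy.
have yd j : y j ^+ d - 1 != 0 by rewrite subr_eq0 generic_pow_neq1.
elim: p => [|p IHp].
  rewrite muln0 alt_sumS0.
  transitivity (laplace_sum (d * 0 + n) (dvd_sign d 0 (n := n)) y).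
    rewrite muln0; apply: eq_laplace => // z gz; rewrite -IHn // muln0.
    by apply: eq_alt_sum => l _ /=; rewrite dvdn0.
  rewrite dvd_sign_step // sign_sum_anti ?subr0 // => j.
  by rewrite muln0 expr0 mulr1 -invrN opprB.
rewrite dvd_parts_sumS // IHp.
rewrite (eq_laplace _ gy (fun z gz => IHn p.+1 z gz)) dvd_sign_step //.
rewrite addrCA -[RHS]addr0; congr (_ + _); apply/eqP; rewrite subr_eq0; apply/eqP.
apply: eq_sign_sum => -[] j //; rewrite mulnS exprD mulrA; congr (_ * _).
have := yd j; have := expf_neq0 d (y0 j).
by move: (y j ^+ d) => z z0 z1; field; rewrite z0 z1.
Qed.

End Recursions.

(** * Partitions whose columns are all even or all odd *)

Section ConjugateParity.

Variable F : fieldType.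

Implicit Types d n m p : nat.

Definition parity_sign (c : F) m n (y : 'I_n -> F) : F :=
  sign_sum (fun b z => if b then c * z ^+ m else 1) y.

Lemma alt_sum_box0 (P : pred (seq nat)) n (y : 'I_n -> F) :
  P (nseq n 0%N) -> alt_sum P 0 y = vdm y.
Proof.
elim: n y P => [|n IHn] y P P0.
  by rewrite alt_sum_ord0 // /vdm /pair_prod big_ord0.
by rewrite alt_sumS0 laplace_vdm; apply: eq_bigr => j _; rewrite IHn.
Qed.

Lemma conj_even_sumS n m (y : 'I_n.+1 -> F) :
  alt_sum (conj_even m.+1) m.+1 y
  = alt_sum (conj_even m) m y
    + laplace_sum (m.+1 + n) (alt_sum (conj_odd m.+1) m.+1) y.
Proof.
rewrite alt_sumSS; congr (_ + _).
  by apply: eq_alt_sum => l lP; exact: conj_evenS lP.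
apply: eq_bigr => j _; congr (_ * _); apply: eq_alt_sum => l _.
exact: conj_even_cons.
Qed.

Lemma conj_odd_sumS n m (y : 'I_n.+1 -> F) :
  alt_sum (conj_odd m.+1) m.+1 y
  = laplace_sum (m.+1 + n) (alt_sum (conj_even m.+1) m.+1) y.
Proof.
rewrite alt_sumSS -[RHS]add0r; congr (_ + _).
  rewrite -(alt_sum_pred0 m y).
  by apply: eq_alt_sum => l lP; exact: conj_oddS lP.
apply: eq_bigr => j _; congr (_ * _); apply: eq_alt_sum => l _.
exact: conj_odd_cons.
Qed.

(** The correction in [res_sum_one] is shared equally between the weights with a = c and a = -c.
    Writing z^m / z instead of a power m - 1 covers m = 0. *)
Lemma parity_sign_step c m n (y : 'I_n.+1 -> F) :
  2 != 0 :> F -> c != 0 -> generic y ->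
  let W a := sign_sum (fun b z => if b then a * (z ^+ m / z) else 1) y in
  c * laplace_sum (m + n) (parity_sign c m (n := n)) y
  = parity_sign c m y - (W c + W (- c)) / 2.
Proof.
move=> two_neq0 c0 gy W; have [y0 _ _ _] := gy.
have E := @sign_sum_step F n (fun z => c * z ^+ m) (fun=> 1) (fun=> 1) y gy
  (fun=> oner_neq0 _) (fun j => mulf_neq0 c0 (expf_neq0 m (y0 j))).
transitivity (\sum_(e : {ffun 'I_n.+1 -> bool})
      \prod_j (if e j then 1 * (c * y j ^+ m) else 1) * sign_term e y
      * res_sum e y (fun=> 1^-1)).
  rewrite -E mulr_sumr; apply: eq_bigr => j _; rewrite addnC exprD.
  rewrite /parity_sign -(@eq_sign_sum _ _ (fun b z => if b then 1 * (c * z ^+ m) else 1)).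
    by ring.
  by case=> i //; rewrite mul1r.
rewrite /W /parity_sign /sign_sum -big_split mulr_suml -sumrB.
apply: eq_bigr => e _; rewrite invr1 res_sum_one // /=.
have EP a : \prod_j (if e j then c * a * (y j ^+ m / y j) else 1)
   = \prod_j (if e j then c * y j ^+ m else 1) * \prod_(j | e j) (a * (y j)^-1).
  rewrite [\prod_(j | e j) _]big_mkcond -big_split; apply: eq_bigr => j _ /=.
  by case: (e j); rewrite ?mulr1 //; ring.
have := EP 1; have := EP (-1).
under [\prod_(j | e j) (-1 * _)]eq_bigr do rewrite mulN1r.
under [\prod_(j | e j) (1 * _)]eq_bigr do rewrite mul1r.
rewrite mulr1 mulrN1 => -> ->.
under [\prod_(j < n.+1) (if e j then 1 * _ else _)]eq_bigr do rewrite mul1r.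
by ring.
Qed.

Lemma parity_sign_N1 n (y : 'I_n.+1 -> F) : parity_sign (-1) 0 y = 0.
Proof. by rewrite /parity_sign sign_sum_anti // => j; rewrite expr0 mulr1 opprK. Qed.

(** [parity_sign_step] for c = 1 and for c = -1 has the same correction, which is eliminated between
    the two. This gives the recursion [laplace_vdm] of the Vandermonde determinant. *)
Lemma parity_sign_add0 n (y : 'I_n -> F) : 2 != 0 :> F -> generic y ->
  parity_sign 1 0 y + parity_sign (-1) 0 y = 2 * vdm y.
Proof.
move=> two_neq0; elim: n y => [|n IHn] y gy.
  by rewrite /parity_sign !sign_sum_ord0 /vdm /pair_prod big_ord0 mulr1.
have := parity_sign_step 0 two_neq0 (oner_neq0 _) gy.
have m10 : -1 != 0 :> F by rewrite oppr_eq0 oner_neq0.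
have := parity_sign_step 0 two_neq0 m10 gy.
rewrite /= parity_sign_N1 addr0 opprK sub0r mul1r mulN1r => /eqP.
rewrite eqr_opp => /eqP EN EP.
rewrite laplace_vdm -laplaceZ -(eq_laplace n gy IHn) laplaceD.
by rewrite add0n in EN EP; rewrite EN EP addrC; ring.
Qed.

(** Induction on [n], then on [m]; the correction in [parity_sign_step] is the half-sum of both
    closed forms at [m], which is the even sum there. For m = n = 0 the empty partition counts as
    both even and odd, and the first formula would give 2 = 1. *)
Lemma conj_parity_sumE n m (y : 'I_n -> F) : 2 != 0 :> F -> generic y ->
  (0 < m + n)%N ->
  alt_sum (conj_even m) m y + alt_sum (conj_odd m) m y = parity_sign 1 m y
  /\ alt_sum (conj_even m) m y - alt_sum (conj_odd m) m y = parity_sign (-1) m y.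
Proof.
move=> two_neq0; elim: n m y => [|n IHn] m y gy.
  rewrite addn0; case: m => // m _; rewrite /parity_sign !sign_sum_ord0.
  rewrite alt_sum_ord0 //; last by apply/allP.
  suff -> : alt_sum (conj_odd m.+1) m.+1 y = 0 by rewrite addr0 subr0.
  by rewrite /alt_sum big_cons big_nil.
move=> _; elim: m => [|m [IHp IHm]].
  have := parity_sign_add0 two_neq0 gy.
  rewrite !alt_sum_box0 // parity_sign_N1 addr0 subrr => ->.
  by split=> //; ring.
have m10 : -1 != 0 :> F by rewrite oppr_eq0 oner_neq0.
rewrite conj_even_sumS conj_odd_sumS.
have EE (z : 'I_n -> F) : generic z -> alt_sum (conj_even m.+1) m.+1 z
  = 2^-1 * parity_sign 1 m.+1 z + 2^-1 * parity_sign (-1) m.+1 z :> F.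
  by move=> gz; have [//|<- <-] := IHn m.+1 z gz; field.
have EO (z : 'I_n -> F) : generic z -> alt_sum (conj_odd m.+1) m.+1 z
  = 2^-1 * parity_sign 1 m.+1 z + - 2^-1 * parity_sign (-1) m.+1 z :> F.
  by move=> gz; have [//|<- <-] := IHn m.+1 z gz; field.
rewrite (eq_laplace _ gy EE) (eq_laplace _ gy EO) !laplaceD !laplaceZ.
have WE a : sign_sum (fun b z => if b then a * (z ^+ m.+1 / z) else 1) y
            = parity_sign a m y.
  apply: eq_sign_sum => -[] j //; congr (_ * _).
  by have [y0 _ _ _] := gy; rewrite exprSr mulfK.
have := parity_sign_step m.+1 two_neq0 (oner_neq0 _) gy.
have := parity_sign_step m.+1 two_neq0 m10 gy.
rewrite /= !WE opprK !mul1r !mulN1r.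
move: (laplace_sum _ _ _) (laplace_sum _ _ _) => Lp Lm.
rewrite -IHp -IHm => /eqP; rewrite eqr_oppLR => /eqP -> ->.
by split; field.
Qed.

End ConjugateParity.

(** * Weyl numerators and denominators *)

Section WeylNumerators.

Variable F : fieldType.

Implicit Types (d m p N : nat) (s : F).

(** One form for the three classical types at constant sequences, with doubled exponents because [r]
    lists square roots. The denominators are s = -1 with N = 1 (type B) or N = 2 (type C), and s = 1
    with N = 0 (type D). *)
Definition weyl_num s N n (r : 'I_n -> F) : F :=
  \det (\matrix_(i < n, j < n)
    (r j ^+ (N + 2 * (n - i.+1)) + s * r j ^- (N + 2 * (n - i.+1)))).

Lemma hpow_nat (r : F) (c : rat) N : 2 * c = N%:R ->
  hpow r c = r ^+ N /\ hpow r (- c) = r ^- N.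
Proof.
move=> cN; rewrite /hpow mulrN numqN cN pmulrn numq_int.
by rewrite exprnP exprnN.
Qed.

Lemma weyl_exp (c : rat) N n (i : 'I_n) :
  2 * c = N%:R -> 2 * (c + n%:R - i.+1%:R) = (N + 2 * (n - i.+1))%:R.
Proof. by move=> cN; rewrite natrD natrM natrB // -cN; ring. Qed.

Lemma det_sp_num n (r : 'I_n -> F) (c : rat) N :
  2 * c + 2 = N%:R -> \det (sp_num r (cst_seq c)) = weyl_num (-1) N r.
Proof.
move=> cN; congr (\det _); apply/matrixP => i j; rewrite !mxE /cst_seq.
have E : 2 * (c + n%:R - i.+1%:R + 1) = (N + 2 * (n - i.+1))%:R.
  by rewrite -(weyl_exp i (c := c + 1)) -?cN; ring.
by have [-> ->] := hpow_nat (r j) E; rewrite mulN1r.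
Qed.

Lemma det_oB_num n (r : 'I_n -> F) (c : rat) N :
  2 * c + 1 = N%:R -> \det (oB_num r (cst_seq c)) = weyl_num (-1) N r.
Proof.
move=> cN; congr (\det _); apply/matrixP => i j; rewrite !mxE /cst_seq.
have E : 2 * (c + n%:R - i.+1%:R + 1 / 2) = (N + 2 * (n - i.+1))%:R.
  by rewrite -(weyl_exp i (c := c + 1 / 2)) -?cN; field.
by have [-> ->] := hpow_nat (r j) E; rewrite mulN1r.
Qed.

Lemma det_oD_num n (r : 'I_n -> F) (c : rat) N :
  2 * c = N%:R -> \det (oD_num r (cst_seq c)) = weyl_num 1 N r.
Proof.
move=> cN; congr (\det _); apply/matrixP => i j; rewrite !mxE /cst_seq.
by have [-> ->] := hpow_nat (r j) (weyl_exp i cN); rewrite mul1r.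
Qed.

Lemma oD_eps_cst n (c : rat) : 0 < c ->
  oD_eps F (cst_seq c : 'I_n -> rat) = if (0 < n)%N then 2 else 1.
Proof.
move=> c0; rewrite /oD_eps; congr (if _ then _ else _).
case: n => [|n]; first by apply/existsP => -[[]].
by apply/existsP; exists ord_max; rewrite /= eqxx.
Qed.

Lemma weyl_num_flip s N n (r : 'I_n -> F) (e : {ffun 'I_n -> bool}) :
  s * s = 1 ->
  weyl_num s N (flip e r) = \prod_j (if e j then 1 else s) * weyl_num s N r.
Proof.
move=> ss; rewrite /weyl_num -det_scale_col; congr (\det _).
apply/matrixP => i j; rewrite !mxE /flip; case: (e j); first by rewrite mul1r.
by rewrite exprVn invrK mulrDr mulrA ss mul1r addrC.
Qed.

Lemma weyl_num_sum s N n (r : 'I_n -> F) :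
  weyl_num s N r
  = \sum_(e : {ffun 'I_n -> bool})
      \prod_j (if e j then r j ^+ N else s * r j ^- N)
      * vdm (flip e (fun j => r j ^+ 2)).
Proof.
rewrite (sum_vdm_flip (fun b j => if b then r j ^+ N else s * r j ^- N)).
congr (\det _); apply/matrixP => i j; by rewrite !mxE -!exprM !(exprD _ N) invfM !mulrA.
Qed.

Section Roots.

Variables (n : nat) (r : 'I_n -> F).
Let x : 'I_n -> F := fun j => r j ^+ 2.
Hypothesis gx : generic x.

Let r0 j : r j != 0.
Proof. by have [x0 _ _ _] := gx; have := x0 j; rewrite expf_eq0. Qed.

Lemma dvd_sign_weyl d p : d \in [:: 1; 2]%N ->
  dvd_sign d p x
  = \prod_j (r j ^+ (d * p) * (r j ^+ d / (x j ^+ d - 1)))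
    * (weyl_num (-1) (d * p + d) r / den x).
Proof.
move=> d12; rewrite /dvd_sign sign_sumE mulrA; congr (_ / _).
rewrite /weyl_num -det_scale_col; congr (\det _); apply/matrixP => i j.
rewrite !mxE.
have := generic_pow_neq1 j d12 gx; rewrite -subr_eq0.
have := expf_neq0 d (r0 j); have := expf_neq0 (d * p) (r0 j).
have := expf_neq0 (n - i.+1) (r0 j).
have xE q : x j ^+ q = (r j ^+ q) ^+ 2 by rewrite /x -!exprM mulnC.
have rE q : r j ^+ (2 * q) = (r j ^+ q) ^+ 2 by rewrite -exprM mulnC.
rewrite !xE !(exprD _ (_ + _)) !(exprD _ _ d) rE.
move: (r j ^+ (n - i.+1)) (r j ^+ (d * p)) (r j ^+ d) => a b c a0 b0 c0 c1.
by field; rewrite a0 b0 c0 c1 -opprB oppr_eq0 c1.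
Qed.

Lemma parity_sign_weyl s m : s * s = 1 ->
  parity_sign s m x = s ^+ n * \prod_j r j ^+ m * (weyl_num s m r / den x).
Proof.
move=> ss; rewrite /parity_sign sign_sumE mulrA; congr (_ / _).
transitivity (\prod_(j < n) (s * r j ^+ m) * weyl_num s m r); last first.
  by rewrite big_split /= prodr_const card_ord.
rewrite /weyl_num -det_scale_col; congr (\det _); apply/matrixP => i j.
have xE q : x j ^+ q = (r j ^+ q) ^+ 2 by rewrite /x -!exprM mulnC.
have rE q : r j ^+ (2 * q) = (r j ^+ q) ^+ 2 by rewrite -exprM mulnC.
rewrite !mxE mulrDr mulrACA ss !xE !(exprD _ m) !rE.
have := expf_neq0 m (r0 j); have := expf_neq0 (n - i.+1) (r0 j).
by move: (r j ^+ (n - i.+1)) (r j ^+ m) => a b a0 b0; field; rewrite a0 b0.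
Qed.

(** The case p = 0 of the summation formula: the box contains only the empty partition, whose
    alternant is [vdm x]. *)
Lemma weyl_denom d : d \in [:: 1; 2]%N ->
  weyl_num (-1) d r * \prod_j (r j ^+ d / (x j ^+ d - 1)) = vdm x * den x.
Proof.
move=> d12; have := dvd_sign_weyl 0 d12.
rewrite -dvd_sumE // muln0 add0n alt_sum_box0 => [->|]; last first.
  by apply/allP => l /nseqP[->]; rewrite dvdn0.
rewrite -mulrA divfK ?generic_den // mulrC; congr (_ * _).
by apply: eq_bigr => j _; rewrite mul1r.
Qed.

Lemma weyl_num_neq0 d : d \in [:: 1; 2]%N -> weyl_num (-1) d r != 0.
Proof.
move=> d12; have := weyl_denom d12; apply: contra_eq_neq => ->.
by rewrite mul0r eq_sym mulf_neq0 ?generic_vdm ?generic_den.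
Qed.

Lemma weyl_denom_sp :
  weyl_num (-1) 2 r = vdm x * den x * \prod_j (x j - (x j)^-1).
Proof.
rewrite -(weyl_denom (d := 2)) // -mulrA -big_split /= big1 ?mulr1 // => j _.
have := generic_pow_neq1 (d := 2) j isT gx; rewrite -subr_eq0.
have [x0 _ _ _] := gx; have := x0 j; rewrite -/(x j) => xj0 xj1.
by rewrite -/(x j); field; rewrite xj0 xj1.
Qed.

(** The case m = 0 of the parity sums. For n > 0 the sign sum with c = -1 vanishes, which leaves the
    factor 2. *)
Lemma weyl_denom_oD : 2 != 0 :> F ->
  weyl_num 1 0 r = (if (0 < n)%N then 2 else 1) * vdm x * den x.
Proof.
move=> two_neq0; have := parity_sign_add0 two_neq0 gx.
rewrite parity_sign_weyl ?mulr1 // expr1n mul1r big1 ?mul1r // => E.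
move: r x gx E; case: n => [|n'] r' x' gx' E.
  by rewrite /weyl_num det_mx00 /vdm /den /pair_prod !big_ord0 !mulr1.
move: E; rewrite parity_sign_N1 addr0 => <-.
by rewrite divfK // generic_den.
Qed.

Lemma alt_dvd_sum d p : d \in [:: 1; 2]%N ->
  alt_sum (dvd_parts d) (d * p) x
  = weyl_num (-1) (d * p + d) r / weyl_num (-1) d r
    * (\prod_j r j ^+ (d * p) * vdm x).
Proof.
move=> d12; rewrite dvd_sumE // dvd_sign_weyl // big_split /=.
have -> : vdm x = weyl_num (-1) d r
                  * (\prod_j (r j ^+ d / (x j ^+ d - 1)) / den x).
  by rewrite mulrA weyl_denom // mulfK // generic_den.
have w0 := weyl_num_neq0 d12; have d0 := generic_den gx.
by field; rewrite w0 d0.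
Qed.

Lemma alt_parity_sum m : 2 != 0 :> F -> (0 < n)%N ->
  alt_sum (conj_even m) m x + alt_sum (conj_odd m) m x
  = 2 * (weyl_num 1 m r / weyl_num 1 0 r) * (\prod_j r j ^+ m * vdm x).
Proof.
move=> two_neq0 n0; have [|-> _] := @conj_parity_sumE F n m x two_neq0 gx.
  by rewrite addn_gt0 n0 orbT.
rewrite parity_sign_weyl ?mulr1 // expr1n mul1r weyl_denom_oD // n0.
have d0 := generic_den gx; have v0 := generic_vdm gx.
by field; rewrite v0 d0 two_neq0.
Qed.

(** The sign (-1)^n comes from [parity_sign_weyl] at s = -1; the product of x_j - 1/x_j appears on
    rewriting [vdm x * den x] through the type C denominator. *)
Lemma alt_parity_diff m : 2 != 0 :> F -> (0 < n)%N ->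
  alt_sum (conj_even m) m x - alt_sum (conj_odd m) m x
  = (-1) ^+ n * (weyl_num (-1) m r / weyl_num (-1) 2 r)
    * \prod_j (x j - (x j)^-1) * (\prod_j r j ^+ m * vdm x).
Proof.
move=> two_neq0 n0; have [|_ ->] := @conj_parity_sumE F n m x two_neq0 gx.
  by rewrite addn_gt0 n0 orbT.
have := weyl_num_neq0 (d := 2) isT.
rewrite parity_sign_weyl ?mulrNN ?mulr1 // weyl_denom_sp.
have d0 := generic_den gx; have v0 := generic_vdm gx.
rewrite mulf_eq0 negb_or => /andP[_ q0].
by field; rewrite v0 d0 q0.
Qed.

End Roots.

End WeylNumerators.

(** * Intermediate characters as weighted sums of alternants *)

Section IntermediateCharacters.

Variables (F : fieldType) (n k : nat) (hk : (k <= n)%N) (r : 'I_n -> F).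
Let x : 'I_n -> F := fun j => r j ^+ 2.
Hypothesis gx : generic x.

Let x0 j : x j != 0.
Proof. by have [x0 _ _ _] := gx. Qed.

Let r0 j : r j != 0.
Proof. by have := x0 j; rewrite expf_eq0. Qed.

Let P j : F := \prod_(l < n | (k <= l)%N) (1 - (x j)^-1 * x l).
Let Q j : F := \prod_(l < n | (k <= l)%N) (1 - x j * x l).

(* For s = -1, the factor of x_j^{+-(lambda_i + n - i)} in column j of the matrix
   M_{lambda + (c^n)}, where c = u/2. *)
Definition sign_weight (s : F) (u : nat) (b : bool) (j : 'I_n) : F :=
  if (j < k)%N then
    if b then r j ^ (u%:Z + 2 * (k%:Z + 1 - n%:Z)) / P j
    else s * (r j ^ (- (u%:Z + 2 * (k%:Z + 1 - n%:Z))) / Q j)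
  else if b then r j ^+ u else 0.

Lemma det_spI_num a l :
  \det (spI_num k x (fun i => nth 0%N l i + a)%N)
  = \sum_(e : {ffun 'I_n -> bool})
      \prod_j sign_weight (-1) (2 * a) (e j) j * alt (flip e x) l.
Proof.
pose f (b : bool) (i j : 'I_n) := sign_weight (-1) (2 * a) b j *
  (if b then x j else (x j)^-1) ^+ (nth 0%N l i + (n - i.+1)).
transitivity (\det (\matrix_(i < n, j < n) \sum_b f b i j)); last first.
  rewrite det_sum_col; apply: eq_bigr => e _.
  by rewrite det_scale_col.
congr (\det _); apply/matrixP => i j; rewrite !mxE big_bool /f /sign_weight.
case: ltnP => _ /=; last first.
  rewrite mul0r addr0 exprM -exprD exprnP; congr (_ ^ _).
  by have := ltn_ord i; lia.
have xE (z : int) : x j ^ z = r j ^ (2 * z).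
  by rewrite /x exprnP exprz_exp.
(* The exponent is that of the alternant plus a + k + 1 - n, which does not depend on the row and
   goes into the weight. *)
have -> : (nth 0%N l i + a)%N%:Z + k%:Z - i.+1%:Z + 1
  = (nth 0%N l i + (n - i.+1))%N%:Z + (a%:Z + (k%:Z + 1 - n%:Z)).
  by have := ltn_ord i; lia.
have -> : (2 * a)%N%:Z + 2 * (k%:Z + 1 - n%:Z) = 2 * (a%:Z + (k%:Z + 1 - n%:Z)).
  by lia.
move: (a%:Z + (k%:Z + 1 - n%:Z)) => z.
rewrite -/(P j) -/(Q j) -(mulrN 2 z) -!xE; move: (P j) (Q j) => Pj Qj.
rewrite opprD !expfzDr ?x0 // exprVn exprnN -!exprnP.
by ring.
Qed.

Lemma prod_tail_const (c : F) : \prod_(l < n | (k <= l)%N) c = c ^+ (n - k).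
Proof. by rewrite -(big_geq_mkord _ _ xpredT) prodr_const_nat. Qed.

Definition tail_vdm : F :=
  \prod_(i < n | (k <= i)%N) \prod_(j < n | (i < j)%N) (x i - x j).

Lemma tail_vdm_neq0 : tail_vdm != 0.
Proof.
have [_ _ xi _] := gx; apply/prodf_neq0 => i _; apply/prodf_neq0 => j ij.
by rewrite subr_eq0 xi // neq_ltn ij.
Qed.

Lemma P_neq0 (j : 'I_n) : (j < k)%N -> P j != 0.
Proof.
move=> jk; have [_ _ xi _] := gx; apply/prodf_neq0 => l kl.
rewrite -(mulVf (x0 j)) -mulrBr mulf_neq0 ?invr_eq0 // subr_eq0 xi //.
by rewrite neq_ltn (leq_trans jk kl).
Qed.

Lemma Q_neq0 (j : 'I_n) : (j < k)%N -> Q j != 0.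
Proof.
move=> jk; have [_ _ _ xn] := gx; apply/prodf_neq0 => l kl.
by rewrite subr_eq0 eq_sym xn // neq_ltn (leq_trans jk kl).
Qed.

(** Inverting a tail variable has weight 0, so only these choices contribute. *)
Definition ext_sign (e : {ffun 'I_k -> bool}) : {ffun 'I_n -> bool} :=
  [ffun j : 'I_n => if insub (j : nat) is Some j' then e j' else true].

Lemma ext_sign_widen e j : ext_sign e (widen_ord hk j) = e j.
Proof. by rewrite ffunE /= valK. Qed.

Lemma ext_sign_tail e (j : 'I_n) : (k <= j)%N -> ext_sign e j.
Proof. by rewrite leqNgt => jk; rewrite ffunE insubF //; apply/negbTE. Qed.

(** The Vandermonde determinant splits into its part on the first [k] variables, the mixed factors,
    and the tail. The mixed factors cancel [P] and [Q], and the first part is summed by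
    [weyl_num_sum]. *)
Lemma sum_sign_weight s u :
  \sum_(e : {ffun 'I_n -> bool})
    \prod_j sign_weight s u (e j) j * vdm (flip e x)
  = weyl_num s (u + 2) (first_vars hk r)
    * \prod_(j < n | (k <= j)%N) r j ^+ u * tail_vdm.
Proof.
rewrite (bigID
  [pred e : {ffun 'I_n -> bool} | [forall j : 'I_n, (k <= j)%N ==> e j]]) /=.
rewrite [X in _ + X]big1 ?addr0 => [|e]; last first.
  case/forallPn => j; rewrite negb_imply => /andP[kj ej].
  by rewrite (bigD1 j) //= /sign_weight ltnNge kj (negPf ej) !mul0r.
rewrite (reindex_onto ext_sign (fun e => [ffun j => e (widen_ord hk j)])) /=; last first.
  move=> e /forallP eT; apply/ffunP => j; rewrite ffunE.
  case: insubP => [j' _ jE|jk].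
    by rewrite ffunE; congr (e _); apply: val_inj.
  by have /implyP -> := eT j; rewrite // leqNgt.
rewrite weyl_num_sum !mulr_suml; apply: eq_big => [e|e _].
  apply/andP; split; first by apply/forallP => j; apply/implyP; exact: ext_sign_tail.
  by apply/eqP/ffunP => j; rewrite ffunE ext_sign_widen.
rewrite (bigID (fun j : 'I_n => (j < k)%N)) /=.
have -> : \prod_(j < n | ~~ (j < k)%N) sign_weight s u (ext_sign e j) j
          = \prod_(j < n | (k <= j)%N) r j ^+ u.
  apply: eq_big => [j|j jk]; first by rewrite -leqNgt.
  by rewrite /sign_weight (negPf jk) ext_sign_tail // leqNgt.
pose y := flip (ext_sign e) x.
have yT (j : 'I_n) : (k <= j)%N -> y j = x j.
  by move=> kj; rewrite /y /flip ext_sign_tail.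
have -> : vdm y = \prod_(i < n | (i < k)%N) \prod_(l < n | (k <= l)%N) (y i - x l)
    * vdm (flip e (fun j => first_vars hk r j ^+ 2)) * tail_vdm.
  rewrite /vdm /pair_prod (bigID (fun j : 'I_n => (j < k)%N)) /=.
  congr (_ * _); last first.
    apply: eq_big => [i|i ik]; first by rewrite -leqNgt.
    have ki : (k <= i)%N by rewrite leqNgt.
    by apply: eq_bigr => j ij; rewrite !yT // (leq_trans ki (ltnW ij)).
  rewrite !(big_ord_narrow hk) -big_split /=; apply: eq_bigr => i _.
  rewrite (bigID (fun j : 'I_n => (j < k)%N)) /= mulrC; congr (_ * _).
    apply: eq_big => [j|j /andP[_ jk]].
      rewrite -leqNgt; apply: andb_idl => kj.
      exact: leq_trans (ltn_ord i) kj.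
    by rewrite [y j]yT // leqNgt.
  rewrite (big_ord_narrow_cond hk) /=; apply: eq_bigr => j _.
  by rewrite /y /flip !ext_sign_widen.
rewrite (big_ord_narrow hk) [\prod_(i < n | (i < k)%N) _](big_ord_narrow hk) /=.
(* The mixed product of variable i is x_i^(n-k) P_i, or x_i^(-(n-k)) Q_i if it is inverted. It
   removes the denominator and turns the exponent u + 2(k + 1 - n) of r_i, up to sign, into u +
   2. *)
have PQE (j : 'I_k) :
  sign_weight s u (ext_sign e (widen_ord hk j)) (widen_ord hk j)
  * \prod_(l < n | (k <= l)%N) (y (widen_ord hk j) - x l)
  = if e j then first_vars hk r j ^+ (u + 2) else s * first_vars hk r j ^- (u + 2).
  rewrite /sign_weight /= ltn_ord ext_sign_widen /y /flip ext_sign_widen.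
  rewrite /first_vars; have jk : (widen_ord hk j < k)%N := ltn_ord j.
  move: (widen_ord hk j) jk => i ik.
  have nk : (n - k)%N%:Z = n%:Z - k%:Z by lia.
  have xE : x i ^+ (n - k) = r i ^ (2 * (n%:Z - k%:Z)).
    by rewrite -nk exprnP /x exprnP exprz_exp.
  case: (e j).
    have -> : \prod_(l < n | (k <= l)%N) (x i - x l) = x i ^+ (n - k) * P i.
      rewrite -prod_tail_const -big_split; apply: eq_bigr => l _ /=.
      by rewrite mulrBr mulr1 mulrA mulfV ?mul1r.
    rewrite mulrCA divfK ?P_neq0 // xE -expfzDr ?r0 // exprnP; congr (_ ^ _).
    by lia.
  have -> : \prod_(l < n | (k <= l)%N) ((x i)^-1 - x l) = x i ^- (n - k) * Q i.
    rewrite -(exprVn (x i)) -prod_tail_const -big_split; apply: eq_bigr => l _ /=.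
    by rewrite mulrBr mulr1 mulrA mulVf ?mul1r.
  rewrite -mulrA; congr (_ * _); rewrite mulrCA divfK ?Q_neq0 // xE invr_expz.
  by rewrite -expfzDr ?r0 // exprnN; congr (_ ^ _); lia.
have -> : \prod_(j < k) (if e j then first_vars hk r j ^+ (u + 2)
                         else s * first_vars hk r j ^- (u + 2))
  = \prod_(j < k) sign_weight s u (ext_sign e (widen_ord hk j)) (widen_ord hk j)
    * \prod_(j < k) \prod_(l < n | (k <= l)%N) (y (widen_ord hk j) - x l).
  by rewrite -big_split; apply: eq_bigr => j _; rewrite -PQE.
by rewrite -/y; ring.
Qed.

End IntermediateCharacters.

(** * Stability under inversion of variables *)

Section Flip.

Variables (F : fieldType) (n : nat).
Implicit Types (y z : 'I_n -> F) (e : {ffun 'I_n -> bool}).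

Lemma eq_generic y z : y =1 z -> generic y -> generic z.
Proof.
move=> yz [y0 y1 yi yn].
by split=> [i|i|i j /yi|i j /yn]; rewrite -!yz.
Qed.

Lemma eq_vdm y z : y =1 z -> vdm y = vdm z.
Proof. by move=> yz; apply: eq_pair_prod => i j _; rewrite !yz. Qed.

Lemma eq_alt_sum_vars (P : pred (seq nat)) m y z :
  y =1 z -> alt_sum P m y = alt_sum P m z.
Proof. by move=> yz; apply: eq_bigr => l _; apply: eq_alt. Qed.

Lemma flipX e y q : flip e (fun j => y j ^+ q) =1 (fun j => flip e y j ^+ q).
Proof. by move=> j; rewrite /flip; case: (e j); rewrite ?exprVn. Qed.

Lemma generic_flip e y : generic y -> generic (flip e y).
Proof.
case=> y0 y1 yi yn; split=> [i|i|i j ij|i j ij]; rewrite /flip.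
- by case: (e i); rewrite ?invr_eq0.
- by case: (e i); rewrite ?exprVn ?invr_eq1.
- case: (e i) (e j) => -[].
  + exact: yi.
  + by apply: contraNneq (yn _ _ ij) => ->; rewrite mulVf.
  + by apply: contraNneq (yn _ _ ij) => <-; rewrite mulfV.
  + by rewrite (inj_eq invr_inj) yi.
case: (e i) (e j) => -[].
- exact: yn.
- by apply: contraNneq (yi _ _ ij) => /divr1_eq ->.
- by apply: contraNneq (yi _ _ ij); rewrite mulrC => /divr1_eq ->.
- by rewrite -invfM invr_eq1 mulrC yn // eq_sym.
Qed.

End Flip.

(** * Bounded sums of intermediate characters *)

Section IntermediateSums.

Variables (F : fieldType) (n k : nat) (hk : (k <= n)%N) (r : 'I_n -> F).
Let x : 'I_n -> F := fun j => r j ^+ 2.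
Hypothesis gx : generic x.
Hypothesis two_neq0 : 2 != 0 :> F.
Implicit Types (e : {ffun 'I_n -> bool}) (m a : nat).

Let r0 j : r j != 0.
Proof. by have [x0 _ _ _] := gx; have := x0 j; rewrite expf_eq0. Qed.

Let gxe e : generic (fun j => flip e r j ^+ 2).
Proof. exact: eq_generic (flipX e r 2) (generic_flip e gx). Qed.

Let rk := first_vars hk r.

Let gk : generic (fun j => rk j ^+ 2).
Proof.
by case: gx => x0 x1 xi xn; split=> [i|i|i j ij|i j ij];
   [apply: x0|apply: x1|apply: xi|apply: xn].
Qed.

Lemma det_spI_num0 :
  \det (spI_num k x (fun=> 0%N)) = weyl_num (-1) 2 rk * tail_vdm k r.
Proof.
transitivity (\det (spI_num k x (fun i => nth 0%N [::] i + 0)%N)).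
  by congr (\det _); apply/matrixP => i j; rewrite !mxE nth_nil.
rewrite (det_spI_num hk gx); under eq_bigr do rewrite alt_nil.
by rewrite (sum_sign_weight hk gx) big1 ?mulr1.
Qed.

Lemma sum_spI (Pr : pred (seq nat)) m a :
  \sum_(lam in Par n m | Pr (part_seq lam)) spI k x (shift_part a lam)
  = (\sum_(e : {ffun 'I_n -> bool})
       \prod_j sign_weight k r (-1) (2 * a) (e j) j * alt_sum Pr m (flip e x))
    / \det (spI_num k x (fun=> 0%N)).
Proof.
transitivity (\sum_(lam in Par n m | Pr (part_seq lam))
   \det (spI_num k x (fun i => nth 0%N (part_seq lam) i + a)%N)
   / \det (spI_num k x (fun=> 0%N))).
  apply: eq_bigr => lam _; congr (\det _ / _); apply/matrixP => i j.
  by rewrite !mxE nth_part_seq.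
rewrite (big_Par n m Pr (fun l => \det (spI_num k x (fun i => nth 0%N l i + a)%N)
   / \det (spI_num k x (fun=> 0%N)))).
rewrite -mulr_suml; congr (_ / _); under eq_bigr do rewrite (det_spI_num hk gx).
by rewrite exchange_big; apply: eq_bigr => e _; rewrite -mulr_sumr.
Qed.

(* Phi is the factor of a bounded Schur sum which changes at most by the sign t
   when a variable is inverted, and therefore leaves the sum over e. *)
Lemma sum_sign_weight_flip m a (Phi t : F) (G : {ffun 'I_n -> bool} -> F) :
  (forall e, G e = Phi * \prod_j (if e j then 1 else t)
                   * (\prod_j flip e r j ^+ m * vdm (flip e x))) ->
  (\sum_(e : {ffun 'I_n -> bool})
      \prod_j sign_weight k r (-1) (2 * a) (e j) j * G e)
    / \det (spI_num k x (fun=> 0%N))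
  = Phi * (weyl_num (- t) (m + 2 * a + 2) rk / weyl_num (-1) 2 rk)
    * \prod_(j < n | (k <= j)%N) r j ^+ (m + 2 * a).
Proof.
move=> GE.
have -> : \sum_(e : {ffun 'I_n -> bool})
      \prod_j sign_weight k r (-1) (2 * a) (e j) j * G e
  = Phi * \sum_(e : {ffun 'I_n -> bool})
      \prod_j sign_weight k r (- t) (m + 2 * a) (e j) j * vdm (flip e x).
  rewrite mulr_sumr; apply: eq_bigr => e _; rewrite GE.
  have -> : \prod_j sign_weight k r (- t) (m + 2 * a) (e j) j
    = \prod_j sign_weight k r (-1) (2 * a) (e j) j
      * \prod_j (if e j then 1 else t) * \prod_j flip e r j ^+ m.
    rewrite -!big_split; apply: eq_bigr => j _ /=; rewrite /sign_weight /flip.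
    rewrite PoszD -addrA; case: (e j); case: ltnP => _ //.
    - by rewrite [r j ^ (m%:Z + _)]expfzDr // -exprnP; ring.
    - by rewrite exprD; ring.
    - rewrite [(- (m%:Z + _))%R]opprD [r j ^ (- m%:Z + _)]expfzDr // -exprnN exprVn.
      by ring.
    - by rewrite !mul0r.
  by ring.
rewrite (sum_sign_weight hk gx) det_spI_num0.
have v0 := tail_vdm_neq0 k gx; have := weyl_num_neq0 (d := 2) gk isT => w0.
by field; rewrite v0 w0.
Qed.

Let prod_one e : \prod_j (if e j then 1 else 1) = 1 :> F.
Proof. by rewrite big1 // => j _; case: (e j). Qed.

Let sign0 e : \prod_j (if e j then 1 else -1) != 0 :> F.
Proof.
by apply/prodf_neq0 => j _; case: (e j); rewrite ?oppr_eq0 ?oner_neq0.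
Qed.

(** Inversions change numerator and denominator of the first ratio by the same sign, so
    [sum_sign_weight_flip] applies with t = 1. *)
Lemma sum_spI_dvd d p a : d \in [:: 1; 2]%N ->
  \sum_(lam in Par n (d * p) | dvd_parts d (part_seq lam))
    spI k x (shift_part a lam)
  = weyl_num (-1) (d * p + d) r / weyl_num (-1) d r
    * (weyl_num (-1) (d * p + 2 * a + 2) rk / weyl_num (-1) 2 rk)
    * \prod_(j < n | (k <= j)%N) r j ^+ (d * p + 2 * a).
Proof.
move=> d12; rewrite sum_spI; apply: sum_sign_weight_flip => e.
rewrite (eq_alt_sum_vars _ _ (flipX e r 2)) (eq_vdm (flipX e r 2)).
rewrite (alt_dvd_sum (gxe e)) // prod_one mulr1; congr (_ * _).
rewrite !weyl_num_flip ?mulrNN ?mulr1 //.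
have w0 := weyl_num_neq0 gx d12.
by field; rewrite sign0 w0.
Qed.

Lemma sum_spI_parity_add m a : (0 < n)%N ->
  \sum_(lam in Par n m | conj_even m (part_seq lam)) spI k x (shift_part a lam)
  + \sum_(lam in Par n m | conj_odd m (part_seq lam)) spI k x (shift_part a lam)
  = 2 * (weyl_num 1 m r / weyl_num 1 0 r)
    * (weyl_num (-1) (m + 2 * a + 2) rk / weyl_num (-1) 2 rk)
    * \prod_(j < n | (k <= j)%N) r j ^+ (m + 2 * a).
Proof.
move=> n0; rewrite !sum_spI -mulrDl -big_split /=.
under eq_bigr do rewrite -mulrDr.
apply: (@sum_sign_weight_flip m a _ 1
  (fun e => alt_sum (conj_even m) m (flip e x) + alt_sum (conj_odd m) m (flip e x))).
move=> e; rewrite !(eq_alt_sum_vars _ _ (flipX e r 2)) (eq_vdm (flipX e r 2)).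
rewrite (alt_parity_sum (gxe e)) // prod_one mulr1; congr (_ * _).
by rewrite !weyl_num_flip ?mulr1 // prod_one !mul1r.
Qed.

(** The product of x_j - 1/x_j changes sign with each inversion, so t = -1. This turns the numerator
    in the first [k] variables from symplectic into even orthogonal. *)
Lemma sum_spI_parity_sub m a : (0 < n)%N ->
  \sum_(lam in Par n m | conj_even m (part_seq lam)) spI k x (shift_part a lam)
  - \sum_(lam in Par n m | conj_odd m (part_seq lam)) spI k x (shift_part a lam)
  = (-1) ^+ n * (weyl_num (-1) m r / weyl_num (-1) 2 r)
    * ((if (0 < k)%N then 2 else 1)
       * (weyl_num 1 (m + 2 * a + 2) rk / weyl_num 1 0 rk))
    * \prod_(j < n | (k <= j)%N) (r j ^+ (m + 2 * a) * (x j - (x j)^-1)).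
Proof.
move=> n0; rewrite !sum_spI -mulrBl -sumrB /=.
under eq_bigr do rewrite -mulrBr.
rewrite (@sum_sign_weight_flip m a
  ((-1) ^+ n * (weyl_num (-1) m r / weyl_num (-1) 2 r)
    * \prod_j (x j - (x j)^-1)) (-1)
  (fun e => alt_sum (conj_even m) m (flip e x) - alt_sum (conj_odd m) m (flip e x))).
  (* The product of x_j - 1/x_j is cut at [k]: its first part converts the type C denominator into
     that of type D, and the tail stays in the result. *)
  rewrite opprK (weyl_denom_sp gk) (weyl_denom_oD gk) // big_split /=.
  rewrite (bigID (fun j : 'I_n => (j < k)%N)) /= (big_ord_narrow hk) /=.
  have -> : \prod_(i < n | ~~ (i < k)%N) (x i - (x i)^-1)
            = \prod_(i < n | (k <= i)%N) (x i - (x i)^-1).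
    by apply: eq_bigl => i; rewrite -leqNgt.
  rewrite -[\prod_(i < k) (x _ - _)]/(\prod_(i < k) (rk i ^+ 2 - (rk i ^+ 2)^-1)).
  have d0 := generic_den gk; have v0 := generic_vdm gk.
  have := weyl_num_neq0 (d := 2) gk isT.
  rewrite (weyl_denom_sp gk) !mulf_eq0 !negb_or => /andP[_ q0].
  have e0 : (if (0 < k)%N then 2 else 1) != 0 :> F.
    by case: ifP; rewrite ?oner_neq0.
  have w0 := weyl_num_neq0 (d := 2) gx isT.
  by field; rewrite v0 d0 q0 e0 w0.
move=> e; rewrite !(eq_alt_sum_vars _ _ (flipX e r 2)) (eq_vdm (flipX e r 2)).
rewrite (alt_parity_diff (gxe e)) //; congr (_ * _).
have -> : \prod_j (flip e r j ^+ 2 - (flip e r j ^+ 2)^-1)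
          = \prod_j (if e j then 1 else -1) * \prod_j (x j - (x j)^-1).
  rewrite -big_split; apply: eq_bigr => j _ /=; rewrite /flip /x.
  by case: (e j); rewrite ?mul1r // exprVn invrK mulN1r opprB.
rewrite !weyl_num_flip ?mulrNN ?mulr1 //.
have w0 := weyl_num_neq0 (d := 2) gx isT.
by field; rewrite sign0 w0.
Qed.

End IntermediateSums.

(** * Genericity of the indeterminates, by evaluation at rational points *)

Lemma tofrac_neq n (p q : {mpoly rat[n]}) (v : 'I_n -> rat) :
  p.@[v] != q.@[v] -> tofrac p != tofrac q :> ratfun n.
Proof.
move=> pq; rewrite -subr_eq0 -tofracB tofrac_eq0 subr_eq0.
by apply: contraNneq pq => ->.
Qed.

Lemma two_ratfun_neq0 n : 2 != 0 :> ratfun n.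
Proof.
rewrite -tofrac0 -(rmorph_nat (@tofrac {mpoly rat[n]})).
by apply: (@tofrac_neq _ _ _ (fun=> 0)); rewrite rmorph_nat meval0.
Qed.

Lemma generic_xvar n : generic (@xvar n).
Proof.
(* Distinct integers at least 2: their squares are distinct, and no fourth power or product of two
   squares equals 1. *)
pose v (i : 'I_n) : rat := i.+2%:R.
have vX (i : 'I_n) : ('X_i : {mpoly rat[n]}).@[v] = i.+2%:R by rewrite mevalXU.
rewrite /xvar /xroot; split=> [i|i|i j ij|i j ij].
- rewrite -tofracXn -tofrac0; apply: (@tofrac_neq _ _ _ v).
  by rewrite meval0 rmorphXn /= vX expf_eq0 pnatr_eq0.
- rewrite -!tofracXn -tofrac1; apply: (@tofrac_neq _ _ _ v).
  by rewrite meval1 !rmorphXn /= vX -!natrX pnatr_eq1; lia.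
- rewrite -!tofracXn; apply: (@tofrac_neq _ _ _ v).
  rewrite !rmorphXn /= !vX -!natrX eqr_nat eqn_exp2r //.
- rewrite -!tofracXn -tofracM -tofrac1; apply: (@tofrac_neq _ _ _ v).
  rewrite meval1 rmorphM !rmorphXn /= !vX -!natrX -natrM pnatr_eq1.
  by rewrite muln_eq1 -(exp1n 2) eqn_exp2r.
Qed.

(** * The four identities for generic variables, then for indeterminates *)

Lemma bounded_spI_sums (F : fieldType) (n k m a : nat) (r : 'I_n -> F)
    (hn : (0 < n)%N) (hk : (k <= n)%N) (hm : (0 < m)%N) :
  let x i := r i ^+ 2 in
  2 != 0 :> F -> generic x ->
  [/\ \sum_(lam in Par n m) spI k x (shift_part a lam)
      = oB r (cst_seq (m%:R / 2))
        * sp (first_vars hk r) (cst_seq (m%:R / 2 + a%:R))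
        * \prod_(i < n | (k <= i)%N) hpow (r i) (m%:R / 2 + a%:R),

      ~~ odd m ->
      \sum_(lam in Even n m) spI k x (shift_part a lam)
      = sp r (cst_seq (m%:R / 2))
        * sp (first_vars hk r) (cst_seq (m%:R / 2 + a%:R))
        * \prod_(i < n | (k <= i)%N) hpow (r i) (m%:R / 2 + a%:R),

      \sum_(lam in Even' n m) spI k x (shift_part a lam)
        + \sum_(lam in Odd' n m) spI k x (shift_part a lam)
      = oD r (cst_seq (m%:R / 2))
        * sp (first_vars hk r) (cst_seq (m%:R / 2 + a%:R))
        * \prod_(i < n | (k <= i)%N) hpow (r i) (m%:R / 2 + a%:R)
    & \sum_(lam in Even' n m) spI k x (shift_part a lam)
        - \sum_(lam in Odd' n m) spI k x (shift_part a lam)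
      = (-1) ^+ n
        * sp r (cst_seq (m%:R / 2 - 1))
        * oD (first_vars hk r) (cst_seq (m%:R / 2 + a%:R + 1))
        * \prod_(i < n | (k <= i)%N)
            (hpow (r i) (m%:R / 2 + a%:R) * (x i - (x i)^-1))].
Proof.
move=> x two0 gx.
have cE : 2 * (m%:R / 2 + a%:R) = (m + 2 * a)%N%:R :> rat.
  by rewrite natrD natrM; field.
have hpE i : hpow (r i) (m%:R / 2 + a%:R) = r i ^+ (m + 2 * a).
  by have [] := hpow_nat (r i) cE.
have spE : sp (first_vars hk r) (cst_seq (m%:R / 2 + a%:R))
  = weyl_num (-1) (m + 2 * a + 2) (first_vars hk r)
    / weyl_num (-1) 2 (first_vars hk r).
  rewrite /sp (@det_sp_num _ _ _ _ (m + 2 * a + 2)) ?(@det_sp_num _ _ _ 0 2) //.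
  by rewrite cE -natrD.
have hpP : \prod_(i < n | (k <= i)%N) hpow (r i) (m%:R / 2 + a%:R)
  = \prod_(i < n | (k <= i)%N) r i ^+ (m + 2 * a).
  by apply: eq_bigr => i _; rewrite hpE.
have m2 : 0 < m%:R / 2 :> rat by rewrite divr_gt0 // ltr0n.
have sumE (V : {set {ffun 'I_n -> 'I_m.+1}}) (Pr : pred (seq nat)) :
  (forall lam, (lam \in V) = (lam \in Par n m) && Pr (part_seq lam)) ->
  \sum_(lam in V) spI k x (shift_part a lam)
  = \sum_(lam in Par n m | Pr (part_seq lam)) spI k x (shift_part a lam).
  by move=> VE; apply: eq_bigl.
have evenE (lam : {ffun 'I_n -> 'I_m.+1}) :
  (lam \in Even' n m) = (lam \in Par n m) && conj_even m (part_seq lam).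
  rewrite inE; congr (_ && _); apply/forallP/allP => h j.
    rewrite mem_iota add0n => /andP[_ jm].
    by have := h (Ordinal jm); rewrite conj_part_seq.
  by rewrite conj_part_seq h // mem_iota add0n ltn_ord.
have oddE (lam : {ffun 'I_n -> 'I_m.+1}) :
  (lam \in Odd' n m) = (lam \in Par n m) && conj_odd m (part_seq lam).
  rewrite inE; congr (_ && _); apply/forallP/allP => h j.
    rewrite mem_iota add0n => /andP[_ jm].
    by have := h (Ordinal jm); rewrite conj_part_seq.
  by rewrite conj_part_seq h // mem_iota add0n ltn_ord.
have dvdE d (lam : {ffun 'I_n -> 'I_m.+1}) :
  dvd_parts d (part_seq lam) = [forall i, d %| lam i]%N.
  rewrite /dvd_parts all_map; apply/allP/forallP => h i; last by move=> _; exact: h.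
  by have := h i; rewrite mem_enum; apply.
split.
- rewrite spE hpP (sumE _ (dvd_parts 1)) => [|lam]; last first.
    rewrite dvdE; suff -> : [forall i, 1 %| lam i]%N by rewrite andbT.
    by apply/forallP => i; rewrite dvd1n.
  have := sum_spI_dvd hk gx m a (d := 1) isT; rewrite mul1n => ->.
  rewrite /oB (@det_oB_num _ _ _ _ (m + 1)) ?(@det_oB_num _ _ _ 0 1) //.
  by rewrite natrD; field.
- move=> evm; rewrite spE hpP (sumE _ (dvd_parts 2)) => [|lam]; last first.
    rewrite dvdE inE; congr (_ && _); apply: eq_forallb => i.
    by rewrite dvdn2.
  have mE : (2 * m./2)%N = m by rewrite mul2n even_halfK.
  have := sum_spI_dvd hk gx m./2 a (d := 2) isT; rewrite mE => ->.
  rewrite [in RHS]/sp (@det_sp_num _ _ _ _ (m + 2)) ?(@det_sp_num _ _ _ 0 2) //.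
  by rewrite natrD; field.
- rewrite spE hpP (sumE _ _ evenE) (sumE _ _ oddE).
  rewrite (sum_spI_parity_add hk gx two0) // /oD oD_eps_cst // hn.
  rewrite (@det_oD_num _ _ _ _ m) ?(@det_oD_num _ _ _ 0 0) //.
  by field.
rewrite (sumE _ _ evenE) (sumE _ _ oddE) (sum_spI_parity_sub hk gx two0) //.
(* The entry m/2 + a + 1 is positive, so the factor is 2 for k > 0 and 1 for k = 0. *)
rewrite /oD oD_eps_cst; last by rewrite addr_gt0 // ltr_wpDr.
rewrite (@det_oD_num _ _ _ _ (m + 2 * a + 2)) ?(@det_oD_num _ _ _ 0 0) //; last first.
  by rewrite natrD -cE; ring.
(* Here 2(m/2 - 1) + 2 = m; for m = 1 the entries are -1/2. *)
rewrite /sp (@det_sp_num _ _ _ _ m) ?(@det_sp_num _ _ _ 0 2) //; last by field.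
by congr (_ * _); apply: eq_bigr => i _; rewrite hpE.
Qed.

Theorem mainTheorem1 (n k m a : nat)
    (hn : (0 < n)%N) (hk : (k <= n)%N) (hm : (0 < m)%N) :
  [/\ \sum_(lam in Par n m) spI k (@xvar n) (shift_part a lam)
      = oB (@xroot n) (cst_seq (m%:R / 2))
        * sp (first_vars hk (@xroot n)) (cst_seq (m%:R / 2 + a%:R))
        * \prod_(i < n | (k <= i)%N) hpow (xroot i) (m%:R / 2 + a%:R),

      ~~ odd m ->
      \sum_(lam in Even n m) spI k (@xvar n) (shift_part a lam)
      = sp (@xroot n) (cst_seq (m%:R / 2))
        * sp (first_vars hk (@xroot n)) (cst_seq (m%:R / 2 + a%:R))
        * \prod_(i < n | (k <= i)%N) hpow (xroot i) (m%:R / 2 + a%:R),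

      \sum_(lam in Even' n m) spI k (@xvar n) (shift_part a lam)
        + \sum_(lam in Odd' n m) spI k (@xvar n) (shift_part a lam)
      = oD (@xroot n) (cst_seq (m%:R / 2))
        * sp (first_vars hk (@xroot n)) (cst_seq (m%:R / 2 + a%:R))
        * \prod_(i < n | (k <= i)%N) hpow (xroot i) (m%:R / 2 + a%:R)
    & \sum_(lam in Even' n m) spI k (@xvar n) (shift_part a lam)
        - \sum_(lam in Odd' n m) spI k (@xvar n) (shift_part a lam)
      = (-1) ^+ n
        * sp (@xroot n) (cst_seq (m%:R / 2 - 1))
        * oD (first_vars hk (@xroot n)) (cst_seq (m%:R / 2 + a%:R + 1))
        * \prod_(i < n | (k <= i)%N)
            (hpow (xroot i) (m%:R / 2 + a%:R) * (xvar i - (xvar i)^-1))].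
Proof. exact: bounded_spI_sums (two_ratfun_neq0 n) (generic_xvar n). Qed.
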